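(* Assume $\mathsf{X}=\mathsf{Y}$ is finite and $D>0$. Then for every $R_c\ge0$, $$\mathcal{R}_e(D,R_c)=\mathcal{R}_e(D,0)=\{R\in\mathbb{R}:\ \exists\,P_{X,Y}\text{ with }P_X=\mu,\ P_Y=\psi,\ \mathbb{E}[\rho(X,Y)]\le D,\ R\ge I(X;Y)\}.$$ In particular the set of empirically achievable pairs is this set of rates times $[0,\infty)$; common randomness does not reduce the required coding rate.
   Context: $\mathsf{X}=\mathsf{Y}$ finite, $\rho=d^p$ for a metric $d$ and $p>0$, $\mu,\psi$ distributions on $\mathsf{X}$. An $(n,R,R_c)$ randomized source code: $X^n$ i.i.d. $\mu$, $K$ uniform on $\{1,\dots,\lceil2^{nR_c}\rceil\}$ independent of $X^n$, stochastic encoder producing $J\in\{1,\dots,\lceil 2^{nR}\rceil\}$ from $(X^n,K)$, stochastic decoder producing $Y^n\in\mathsf{Y}^n$ from $(J,K)$. For a random sequence $Y^n$, $p_{Y^n}$ denotes its empirical distribution, and $\|\gamma-\nu\|_{TV}=\frac12\sum_v|\gamma(v)-\nu(v)|$. A pair $(R,R_c)$ is empirically achievable at distortion $D$ if there is a sequence of $(n,R,R_c)$ codes with $\limsup_n\mathbb{E}[\frac1n\sum_i\rho(X_i,Y_i)]\le D$ and $\|p_{Y^n}-\psi\|_{TV}\to0$ in probability. $\mathcal{R}_e(D,R_c)$ is the set of $R$ such that $(R,R_c)$ is empirically achievable.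
   Formalization: Rates R are restricted to R ≥ 0; for R < 0 the message set of size ⌈2^{nR}⌉ = 1 equals that at R = 0, so negative R can be achievable (e.g. a one-point alphabet) although the right-hand set contains only R ≥ I(X;Y) ≥ 0. *)

(* Defs.v *)
From HB Require Import structures.
From mathcomp Require Import all_boot.
From Stdlib Require Import Reals.

Set Implicit Arguments. Unset Strict Implicit. Unset Printing Implicit Defensive.

Local Open Scope R_scope.

Definition rsum (T : finType) (f : T -> R) : R := \big[Rplus/0]_(i : T) f i.

Definition is_pmf (T : finType) (f : T -> R) : Prop :=
  (forall t, 0 <= f t) /\ rsum f = 1.

Definition is_metric (T : Type) (d : T -> T -> R) : Prop :=
  (forall x y, 0 <= d x y) /\ (forall x y, d x y = 0 <-> x = y) /\
  (forall x y, d x y = d y x) /\ (forall x y z, d x z <= d x y + d y z).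

(* a^p for a >= 0, p > 0, with 0^p = 0 *)
Definition rpow (a p : R) : R := if Rle_dec a 0 then 0 else Rpower a p.

Definition rho (T : Type) (d : T -> T -> R) (p : R) (x y : T) : R := rpow (d x y) p.

(* ceiling of a real, as a natural number (used only for positive reals) *)
Definition ceilR (x : R) : nat :=
  Z.to_nat (if Req_dec_T (IZR (up x) - 1) x then (up x - 1)%Z else up x).

Definition code_size (n : nat) (r : R) : nat := ceilR (Rpower 2 (INR n * r)).

Definition log2 (a : R) : R := ln a / ln 2.

Definition iid (X : finType) (mu : X -> R) (n : nat) (x : n.-tuple X) : R :=
  \big[Rmult/1]_(i < n) mu (tnth x i).

(* types of randomized encoders and decoders of an (n,R,Rc) code:
   enc x k j = P(J = j | X^n = x, K = k),  dec j k y = P(Y^n = y | J = j, K = k) *)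
Definition encoder (X : finType) (n : nat) (Rr Rc : R) : Type :=
  n.-tuple X -> 'I_(code_size n Rc) -> 'I_(code_size n Rr) -> R.
Definition decoder (X : finType) (n : nat) (Rr Rc : R) : Type :=
  'I_(code_size n Rr) -> 'I_(code_size n Rc) -> n.-tuple X -> R.

Definition valid_code (X : finType) (n : nat) (Rr Rc : R)
  (enc : encoder X n Rr Rc) (dec : decoder X n Rr Rc) : Prop :=
  (forall x k, is_pmf (enc x k)) /\ (forall j k, is_pmf (dec j k)).

(* expectation of g(X^n,K,J,Y^n) under the joint law induced by the code,
   with X^n iid mu and K uniform on {1..ceil(2^{n Rc})} independent of X^n *)
Definition code_expect (X : finType) (mu : X -> R) (n : nat) (Rr Rc : R)
  (enc : encoder X n Rr Rc) (dec : decoder X n Rr Rc)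
  (g : n.-tuple X -> 'I_(code_size n Rc) -> 'I_(code_size n Rr) -> n.-tuple X -> R) : R :=
  rsum (fun x => rsum (fun k => rsum (fun j => rsum (fun y =>
    iid mu x * / INR (code_size n Rc) * enc x k j * dec j k y * g x k j y)))).

Definition emp (X : finType) (n : nat) (y : n.-tuple X) (v : X) : R :=
  INR (count_mem v y) / INR n.

Definition tv (X : finType) (f g : X -> R) : R := / 2 * rsum (fun v => Rabs (f v - g v)).

Definition avg_dist (X : finType) (d : X -> X -> R) (p : R) (n : nat)
  (x y : n.-tuple X) : R := / INR n * rsum (fun i : 'I_n => rho d p (tnth x i) (tnth y i)).

Definition emp_achievable (X : finType) (d : X -> X -> R) (p : R) (mu psi : X -> R)
  (D Rr Rc : R) : Prop :=
  exists (enc : forall n : nat, encoder X n Rr Rc) (dec : forall n : nat, decoder X n Rr Rc),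
    (forall n, valid_code (enc n) (dec n)) /\
    (forall eps, 0 < eps -> exists N : nat, forall n : nat, (N <= n)%nat ->
       code_expect mu (enc n) (dec n) (fun x _ _ y => avg_dist d p x y) <= D + eps) /\
    (forall eps, 0 < eps ->
       Un_cv (fun n => code_expect mu (enc n) (dec n)
                (fun _ _ _ y => if Rlt_dec eps (tv (emp y) psi) then 1 else 0)) 0).

Definition mutual_info (X : finType) (P : X * X -> R) : R :=
  rsum (fun xy : X * X =>
    if Req_dec_T (P xy) 0 then 0
    else P xy * log2 (P xy / (rsum (fun y => P (xy.1, y)) * rsum (fun x => P (x, xy.2))))).

Definition rate_set (X : finType) (d : X -> X -> R) (p : R) (mu psi : X -> R)
  (D Rr : R) : Prop :=
  exists P : X * X -> R, is_pmf P /\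
    (forall x, rsum (fun y => P (x, y)) = mu x) /\
    (forall y, rsum (fun x => P (x, y)) = psi y) /\
    rsum (fun xy : X * X => P xy * rho d p xy.1 xy.2) <= D /\
    mutual_info P <= Rr.

(* Main.v *)
(** Converse: for a positive function [r] with [sum_a mu a * r a b <= 1], Gibbs' inequality
    and [P (J = j | X^n, K) <= 1] give [E (sum_i ln (r X_i Y_i)) <= ln M], where [M] is the
    number of messages and whatever the amount of common randomness. This bound, the marginals
    and the distortion are linear in the mean joint empirical distribution of [(X^n, Y^n)], so
    they pass to any cluster point [P] of these distributions; taking for [r] the density of
    [P] with respect to [mu x psi], mixed with a small constant, gives [I(P) <= R].

    Achievability: if [R > 0], mixing [P] with [mu x psi] makes [I(P) < R] at a small cost in
    distortion, and a greedily chosen codebook contains, for most source words, a codeword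
    that is jointly typical with it. If [R = 0] then [P = mu x psi], and the decoder
    emits an i.i.d. [psi] sequence. Joint typicality controls both the distortion and the
    empirical distribution of the output. *)
Require Import Defs.
From HB Require Import structures.
From mathcomp Require Import all_boot.
From Stdlib Require Import Reals Lra Classical ClassicalEpsilon.

Set Implicit Arguments. Unset Strict Implicit. Unset Printing Implicit Defensive.

Local Open Scope R_scope.

(** * Finite sums and products of reals, through the generic big-operator theory *)

HB.instance Definition _ := Monoid.isComLaw.Build R 0 Rplus
  (fun x y z => esym (Rplus_assoc x y z)) Rplus_comm Rplus_0_l.
HB.instance Definition _ := Monoid.isComLaw.Build R 1 Rmult
  (fun x y z => esym (Rmult_assoc x y z)) Rmult_comm Rmult_1_l.
HB.instance Definition _ := Monoid.isMulLaw.Build R 0 Rmult Rmult_0_l Rmult_0_r.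
HB.instance Definition _ := Monoid.isAddLaw.Build R Rmult Rplus
  Rmult_plus_distr_r Rmult_plus_distr_l.

Definition indic (b : bool) : R := if b then 1 else 0.

Lemma indic_bounds (b : bool) : 0 <= indic b <= 1.
Proof. by case: b => /=; lra. Qed.

Section FiniteSums.
Variables T U : finType.
Implicit Types f g : T -> R.

Lemma eq_rsum f g : f =1 g -> rsum f = rsum g.
Proof. by move=> fg; apply: eq_bigr => i _. Qed.

Lemma rsumD f g : rsum (fun t => f t + g t) = rsum f + rsum g.
Proof. exact: big_split. Qed.

Lemma rsumMl (a : R) f : rsum (fun t => a * f t) = a * rsum f.
Proof. by rewrite /rsum big_distrr. Qed.

Lemma rsumMr (a : R) f : rsum (fun t => f t * a) = rsum f * a.
Proof. by rewrite /rsum big_distrl. Qed.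

Lemma rsumB f g : rsum (fun t => f t - g t) = rsum f - rsum g.
Proof.
rewrite (_ : rsum f - rsum g = rsum f + -1 * rsum g); last by ring.
by rewrite -rsumMl -rsumD; apply: eq_rsum => t; ring.
Qed.

Lemma rsum_const (a : R) : rsum (fun _ : T => a) = INR #|T| * a.
Proof.
rewrite /rsum big_const; elim: #|T| => [|n IHn] /=; first by ring.
by rewrite IHn -/(INR n.+1) S_INR; ring.
Qed.

Lemma rsum_le f g : (forall t, f t <= g t) -> rsum f <= rsum g.
Proof.
move=> fg; apply: (big_ind2 (fun a b => a <= b)) => [|a b c d|i _]; try lra.
exact: fg.
Qed.

Lemma rsum_ge0 f : (forall t, 0 <= f t) -> 0 <= rsum f.
Proof.
by move=> f0; apply: (big_ind (fun a => 0 <= a)) => [|a b|i _]; try lra; apply: f0.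
Qed.

Lemma rsum_delta (t0 : T) f : rsum (fun t => indic (t == t0) * f t) = f t0.
Proof.
rewrite /rsum (bigD1 t0) //= eqxx big1 /= => [|t /negbTE->] /=; ring.
Qed.

Lemma le_rsum (t0 : T) f : (forall t, 0 <= f t) -> f t0 <= rsum f.
Proof.
move=> f0; rewrite -(rsum_delta t0 f); apply: rsum_le => t.
by case: (t == t0) => /=; have := f0 t; lra.
Qed.

Lemma exchange_rsum (F : T -> U -> R) :
  rsum (fun t => rsum (F t)) = rsum (fun u => rsum (fun t => F t u)).
Proof. exact: exchange_big. Qed.

Lemma rsum_pair (F : T -> U -> R) :
  rsum (fun t => rsum (F t)) = rsum (fun c : T * U => F c.1 c.2).
Proof. exact: pair_bigA. Qed.

Lemma rsum_abs_le f : Rabs (rsum f) <= rsum (fun t => Rabs (f t)).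
Proof.
apply: (big_ind2 (fun a b => Rabs a <= b)) => [|a b c d ab cd|i _].
- by rewrite Rabs_R0; lra.
- by have := Rabs_triang a c; lra.
- lra.
Qed.

Lemma pmf_le1 f t : is_pmf f -> f t <= 1.
Proof. by case=> f0 <-; apply: le_rsum. Qed.

End FiniteSums.

Lemma prod_ge0 n (f : 'I_n -> R) :
  (forall i, 0 <= f i) -> 0 <= \big[Rmult/1]_(i < n) f i.
Proof.
move=> f0; apply: (big_ind (fun a => 0 <= a)) => [|a b|i _] //; first lra.
exact: Rmult_le_pos.
Qed.

Lemma prod_gt0 n (f : 'I_n -> R) :
  (forall i, 0 < f i) -> 0 < \big[Rmult/1]_(i < n) f i.
Proof.
move=> f0; apply: (big_ind (fun a => 0 < a)) => [|a b|i _] //; first lra.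
exact: Rmult_lt_0_compat.
Qed.

Lemma prod_le1 n (f : 'I_n -> R) :
  (forall i, 0 <= f i <= 1) -> \big[Rmult/1]_(i < n) f i <= 1.
Proof.
move=> f01; suff: 0 <= \big[Rmult/1]_(i < n) f i <= 1 by lra.
apply: (big_ind (fun a => 0 <= a <= 1)) => [|a b ha hb|i _] //; first lra.
by split; nra.
Qed.

Lemma ln_prod n (f : 'I_n -> R) : (forall i, 0 < f i) ->
  ln (\big[Rmult/1]_(i < n) f i) = rsum (fun i => ln (f i)).
Proof.
move=> f0; suff: 0 < \big[Rmult/1]_(i < n) f i /\
  ln (\big[Rmult/1]_(i < n) f i) = rsum (fun i => ln (f i)) by case.
apply: (big_ind2 (fun a b => 0 < a /\ ln a = b)) => [|a b c e [a0 <-] [c0 <-]|i _].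
- by split; [lra | exact: ln_1].
- by split; [exact: Rmult_lt_0_compat | rewrite ln_mult].
- by split.
Qed.

Lemma ln_le_sub1 (t : R) : 0 < t -> ln t <= t - 1.
Proof. by move=> t0; have := exp_ineq1_le (ln t); rewrite exp_ln //; lra. Qed.

Section Tuples.
Variable n : nat.

(** Distributivity expands the product of sums into a sum over choice functions, which are
    re-indexed as words. *)
Lemma rsum_tuple_prod (T : finType) (F : 'I_n -> T -> R) :
  rsum (fun x : n.-tuple T => \big[Rmult/1]_(i < n) F i (tnth x i)) =
  \big[Rmult/1]_(i < n) rsum (F i).
Proof.
rewrite /rsum bigA_distr_bigA /=.
rewrite (reindex (fun f : {ffun 'I_n -> T} => [tuple f i | i < n])) /=.
  by apply: eq_bigr => f _; apply: eq_bigr => i _; rewrite tnth_mktuple.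
apply: onW_bij; exists (fun x : n.-tuple T => [ffun i => tnth x i]) => [f|x].
  by apply/ffunP => i; rewrite ffunE tnth_mktuple.
by apply: eq_from_tnth => i; rewrite tnth_mktuple ffunE.
Qed.

(** Zipping is a bijection onto words over the product alphabet, so pairs of words can be treated as
    one i.i.d. word. *)
Lemma rsum_zip (T U : finType) (F : n.-tuple (T * U) -> R) :
  rsum (fun x : n.-tuple T => rsum (fun y : n.-tuple U => F [tuple of zip x y])) =
  rsum F.
Proof.
rewrite rsum_pair /rsum.
rewrite (reindex (fun z : n.-tuple (T * U) =>
  ([tuple of map fst z], [tuple of map snd z]))) /=.
  by apply: eq_bigr => z _; congr F; apply: val_inj; rewrite /= zip_unzip.
apply: onW_bij; exists (fun p : n.-tuple T * n.-tuple U => [tuple of zip p.1 p.2]) => [z|[x y]] /=.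
  by apply: val_inj; rewrite /= zip_unzip.
by congr pair; apply: val_inj; rewrite /= -/unzip1 -/unzip2
  ?unzip1_zip ?unzip2_zip // !size_tuple.
Qed.

Lemma tnth_zip (T U : Type) (x : n.-tuple T) (y : n.-tuple U) i :
  tnth [tuple of zip x y] i = (tnth x i, tnth y i).
Proof.
rewrite (tnth_nth (tnth x i, tnth y i)) /= nth_zip ?size_tuple //.
by rewrite -!tnth_nth.
Qed.

End Tuples.


(** * Empirical distributions *)

Lemma iid_pmf (T : finType) (P : T -> R) n : is_pmf P -> is_pmf (@iid T P n).
Proof.
case=> P0 P1; split=> [x|]; first by apply: prod_ge0 => i.
by rewrite /iid (rsum_tuple_prod (fun _ : 'I_n => P)) big1.
Qed.

Lemma iid_gt0 (T : finType) (P : T -> R) n (x : n.-tuple T) i :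
  (forall t, 0 <= P t) -> 0 < iid P x -> 0 < P (tnth x i).
Proof.
move=> P0; rewrite /iid (bigD1 i) //=.
by case: (P0 (tnth x i)) => // <-; rewrite Rmult_0_l; lra.
Qed.

Lemma empE (T : finType) n (z : n.-tuple T) v :
  emp z v = / INR n * rsum (fun i => indic (v == tnth z i)).
Proof.
rewrite /emp /Rdiv Rmult_comm; congr (_ * _).
rewrite /rsum -(big_tuple _ _ _ xpredT (fun t => indic (v == t))).
elim: (tval z) => [|t s IHs]; first by rewrite big_nil.
by rewrite big_cons -IHs /= plus_INR eq_sym; case: (v == t).
Qed.

Lemma emp_mean (T : finType) n (z : n.-tuple T) (f : T -> R) :
  rsum (fun v => emp z v * f v) = / INR n * rsum (fun i => f (tnth z i)).
Proof.
under eq_rsum => v do rewrite empE Rmult_assoc -rsumMr.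
rewrite rsumMl exchange_rsum; congr (_ * _); apply: eq_rsum => i.
exact: (rsum_delta (tnth z i)).
Qed.

Lemma emp_ge0 (T : finType) n (z : n.-tuple T) v : 0 <= emp z v.
Proof.
rewrite /emp; case: n z => [|n] z.
  by rewrite tuple0 /= /Rdiv Rmult_0_l; lra.
by apply: Rle_mult_inv_pos; [exact: pos_INR | apply: lt_0_INR; apply/ltP].
Qed.

Lemma emp_pmf (T : finType) n (z : n.-tuple T) : (0 < n)%nat -> is_pmf (emp z).
Proof.
move=> n0; split=> [v|]; first exact: emp_ge0.
transitivity (rsum (fun v => emp z v * 1)); first by apply: eq_rsum => v; ring.
rewrite emp_mean rsum_const card_ord; field.
by apply: not_0_INR => n00; rewrite n00 in n0.
Qed.

(** Puts a marginal in the form of a linear functional of [P], the form in which limits are taken in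
    the converse. *)
Lemma marginal_fst (T U : finType) (P : T * U -> R) a :
  rsum (fun c => P c * indic (a == c.1)) = rsum (fun b => P (a, b)).
Proof.
transitivity (rsum (fun a' => rsum (fun b => P (a', b) * indic (a == a')))).
  by rewrite rsum_pair; apply: eq_rsum => -[].
rewrite exchange_rsum; apply: eq_rsum => b; rewrite -(rsum_delta a (fun a' => P (a', b))).
by apply: eq_rsum => a'; rewrite (eq_sym a a') Rmult_comm.
Qed.

Lemma marginal_snd (T U : finType) (P : T * U -> R) b :
  rsum (fun c => P c * indic (b == c.2)) = rsum (fun a => P (a, b)).
Proof.
transitivity (rsum (fun a => rsum (fun b' => P (a, b') * indic (b == b')))).
  by rewrite rsum_pair; apply: eq_rsum => -[].
apply: eq_rsum => a; rewrite -(rsum_delta b (fun b' => P (a, b'))).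
by apply: eq_rsum => b'; rewrite (eq_sym b b') Rmult_comm.
Qed.

Lemma emp_zip_snd (T U : finType) n (x : n.-tuple T) (y : n.-tuple U) b :
  emp y b = rsum (fun a => emp [tuple of zip x y] (a, b)).
Proof.
rewrite -marginal_snd emp_mean empE; congr (_ * _); apply: eq_rsum => i.
by rewrite tnth_zip.
Qed.

Lemma avg_distE (X : finType) (d : X -> X -> R) p n (x y : n.-tuple X) :
  avg_dist d p x y = rsum (fun c => emp [tuple of zip x y] c * rho d p c.1 c.2).
Proof.
by rewrite emp_mean; congr (_ * _); apply: eq_rsum => i; rewrite tnth_zip.
Qed.

(** * Weak law of large numbers for empirical distributions *)

Section WeakLaw.
Variables (T : finType) (P : T -> R) (n : nat).
Hypothesis Ppmf : is_pmf P.

Lemma iid_mean (f : T -> R) i :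
  rsum (fun z : n.-tuple T => iid P z * f (tnth z i)) = rsum (fun t => P t * f t).
Proof.
(* The factor [f] sits at coordinate [i] only, so the summand is a product over coordinates and all
   other factors sum to 1. *)
pose F k t := P t * (if k == i then f t else 1).
transitivity (rsum (fun z : n.-tuple T => \big[Rmult/1]_(k < n) F k (tnth z k))).
  by apply: eq_rsum => z; rewrite /F big_split /= -big_mkcond big_pred1_eq.
rewrite rsum_tuple_prod (bigD1 i) //= {1}/F eqxx big1 => [|k /negbTE ki].
  by rewrite Rmult_1_r.
by rewrite -(proj2 Ppmf); apply: eq_rsum => t; rewrite /F ki; ring.
Qed.

(** Distinct coordinates are independent, so the factor at [i] contributes the mean of [h], which is
    0. *)
Lemma iid_cov (h : T -> R) i j : rsum (fun t => P t * h t) = 0 ->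
  rsum (fun z : n.-tuple T => iid P z * (h (tnth z i) * h (tnth z j))) =
  indic (j == i) * rsum (fun t => P t * h t ^ 2).
Proof.
move=> h0; have [->|ji] := eqVneq j i.
  rewrite (iid_mean (fun t => h t * h t)) [indic _]/= Rmult_1_l; apply: eq_rsum => t.
  ring.
pose F k t := P t * ((if k == i then h t else 1) * (if k == j then h t else 1)).
transitivity (rsum (fun z : n.-tuple T => \big[Rmult/1]_(k < n) F k (tnth z k))).
  by apply: eq_rsum => z; rewrite /F !big_split /= -!big_mkcond !big_pred1_eq.
rewrite rsum_tuple_prod (bigD1 i) //= (_ : rsum (F i) = 0); first by rewrite /=; ring.
rewrite -h0; apply: eq_rsum => t; rewrite /F eqxx eq_sym (negbTE ji); ring.
Qed.

Lemma iid_variance (h : T -> R) : rsum (fun t => P t * h t) = 0 ->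
  rsum (fun z : n.-tuple T => iid P z * rsum (fun i => h (tnth z i)) ^ 2) =
  INR n * rsum (fun t => P t * h t ^ 2).
Proof.
move=> h0.
under eq_rsum => z.
  rewrite /= Rmult_1_r -rsumMr -rsumMl.
  under eq_rsum => i do rewrite -rsumMl -rsumMl.
  over.
rewrite exchange_rsum.
under eq_rsum => i.
  rewrite exchange_rsum.
  under eq_rsum => j do rewrite iid_cov //.
  rewrite (rsum_delta i (fun _ => rsum (fun t => P t * h t ^ 2))).
  over.
by rewrite rsum_const card_ord.
Qed.

(** Strong typicality; for [P] on pairs this is joint typicality of two zipped words. *)
Definition typical (dl : R) (z : n.-tuple T) : bool :=
  [forall c, Rle_dec (Rabs (emp z c - P c)) dl].

Lemma typicalP dl (z : n.-tuple T) :
  reflect (forall c, Rabs (emp z c - P c) <= dl) (typical dl z).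
Proof.
apply: (iffP forallP) => zP c; first by have := zP c; case: Rle_dec.
by case: Rle_dec => // nle; case: nle.
Qed.

(** Chebyshev's inequality for the frequency of each letter, with a union bound over letters: the
    centred indicator [h] of a letter has second moment at most 1. *)
Lemma weak_law dl : (0 < n)%nat -> 0 < dl ->
  rsum (fun z : n.-tuple T => iid P z * indic (~~ typical dl z)) <=
  INR #|T| / (INR n * dl ^ 2).
Proof.
move=> n_gt0 dl0; have n0 : 0 < INR n by apply: lt_0_INR; apply/ltP.
have [I0 _] := iid_pmf n Ppmf.
apply: (@Rle_trans _ (rsum (fun z : n.-tuple T => rsum (fun c =>
   iid P z * ((emp z c - P c) ^ 2 * / dl ^ 2))))).
  apply: rsum_le => z; rewrite rsumMl; apply: Rmult_le_compat_l; first exact: I0.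
  have s0 c : 0 <= (emp z c - P c) ^ 2 * / dl ^ 2.
    apply: Rmult_le_pos; first exact: pow2_ge_0.
    by apply/Rlt_le/Rinv_0_lt_compat; nra.
  case: (boolP (typical dl z)) => [_|/forallPn[c]] /=; first exact: rsum_ge0.
  case: Rle_dec => // /Rnot_le_lt far _; apply: (Rle_trans _ _ _ _ (le_rsum c s0)).
  rewrite -(pow2_abs (emp z c - P c)); apply: (Rmult_le_reg_r (dl ^ 2)); first nra.
  rewrite Rmult_assoc Rinv_l; nra.
rewrite exchange_rsum.
apply: (@Rle_trans _ (rsum (fun _ : T => / (INR n * dl ^ 2)))); last first.
  by rewrite rsum_const /Rdiv; lra.
apply: rsum_le => c.
pose h t := indic (c == t) - P c.
have meanP : rsum (fun t => P t * indic (c == t)) = P c.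
  by rewrite -[RHS](rsum_delta c P); apply: eq_rsum => t; rewrite eq_sym Rmult_comm.
have h0 : rsum (fun t => P t * h t) = 0.
  rewrite /h; under eq_rsum => t do rewrite Rmult_minus_distr_l.
  by rewrite rsumB meanP rsumMr (proj2 Ppmf); ring.
have h1 : rsum (fun t => P t * h t ^ 2) <= 1.
  rewrite -(proj2 Ppmf); apply: rsum_le => t; have := proj1 Ppmf t.
  have := proj1 Ppmf c; have := pmf_le1 c Ppmf; have := indic_bounds (c == t).
  rewrite /h => *; rewrite -[X in _ <= X]Rmult_1_r.
  by apply: Rmult_le_compat_l; nra.
pose S (z : n.-tuple T) := rsum (fun i => h (tnth z i)).
have dev z : emp z c - P c = / INR n * S z.
  by rewrite /S /h rsumB rsum_const card_ord empE; field; lra.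
rewrite (@eq_rsum _ _ (fun z : n.-tuple T =>
  iid P z * S z ^ 2 * (/ INR n ^ 2 * / dl ^ 2))); last first.
  by move=> z; rewrite dev; field; lra.
rewrite rsumMr (iid_variance h0).
rewrite (_ : / (INR n * dl ^ 2) = INR n * 1 * (/ INR n ^ 2 * / dl ^ 2)); last by field; lra.
apply: Rmult_le_compat_r; last by apply: Rmult_le_compat_l; lra.
by apply/Rlt_le/Rmult_lt_0_compat; apply/Rinv_0_lt_compat; nra.
Qed.

End WeakLaw.

(** * Converse *)

(** Bolzano-Weierstrass one coordinate at a time, by induction along the enumeration of [T]. *)
Lemma cluster_point (T : finType) (f : nat -> T -> R) :
  (forall n t, 0 <= f n t <= 1) ->
  exists l : T -> R, forall eps, 0 < eps -> forall N : nat,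
    exists n, (N <= n)%nat /\ forall t, Rabs (f n t - l t) < eps.
Proof.
move=> f01; suff [l lP] : exists l : T -> R, forall eps, 0 < eps -> forall N : nat,
    exists n, (N <= n)%nat /\ forall t, t \in enum T -> Rabs (f n t - l t) < eps.
  exists l => eps eps0 N; have [n [Nn nP]] := lP eps eps0 N.
  by exists n; split=> // t; apply: nP; rewrite mem_enum.
elim: (enum T) f f01 => [|t s IHs] f f01.
  by exists (fun _ => 0) => eps _ N; exists N; split.
have [a aP] := Bolzano_Weierstrass (fun n => f n t) _ (compact_P3 0 1) (fun n => f01 n t).
have {}aP N : exists n, (N <= n)%nat /\ Rabs (f n t - a) < / (INR N + 1).
  have N0 : 0 < / (INR N + 1) by apply: Rinv_0_lt_compat; have := pos_INR N; lra.
  have [n [Nn nP]] := aP (disc a (mkposreal _ N0)) N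
    (ex_intro _ (mkposreal _ N0) (fun x xP => xP)).
  by exists n; split=> //; apply/leP.
(* The map [g] may fail to be increasing; [N <= g N] is enough to produce arbitrarily late
   indices. *)
have [g gP] := choice _ aP.
have [l lP] := IHs (fun n => f (g n)) (fun n => f01 (g n)).
exists (fun u => if u == t then a else l u) => eps eps0 N.
have [k [keps k0]] := archimed_cor1 eps eps0.
have [n [Nn nP]] := lP eps eps0 (maxn N k).
have [gn gna] := gP n.
exists (g n); split; first by apply: leq_trans gn; apply: leq_trans Nn; apply: leq_maxl.
move=> u; rewrite inE; case: eqVneq => [->|_] /=; last exact: nP.
move=> _; apply: (Rlt_trans _ _ _ gna); apply: Rlt_trans keps.
apply: Rinv_lt_contravar.
  by apply: Rmult_lt_0_compat; [exact: lt_0_INR | have := pos_INR n; lra].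
suff : INR k <= INR n by lra.
by apply/le_INR/leP; apply: leq_trans Nn; apply: leq_maxr.
Qed.

(** A linear functional on a finite set is continuous, with modulus given by the sum [F] of the
    absolute values of [f], so an asymptotic bound passes to the cluster point. In the proof [dl] is
    half the supposed gap. *)
Lemma cluster_le (T : finType) (Q : nat -> T -> R) (P f : T -> R) (v : R) :
  (forall eps, 0 < eps -> forall N : nat,
    exists n, (N <= n)%nat /\ forall t, Rabs (Q n t - P t) < eps) ->
  (forall eps, 0 < eps -> exists N : nat, forall n, (N <= n)%nat ->
    rsum (fun t => Q n t * f t) <= v + eps) ->
  rsum (fun t => P t * f t) <= v.
Proof.
move=> clP le_v; apply: Rnot_lt_le => lt_v.
pose dl := (rsum (fun t => P t * f t) - v) / 2.
have dl0 : 0 < dl by rewrite /dl; lra.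
pose F := rsum (fun t => Rabs (f t)).
have F0 : 0 <= F by apply: rsum_ge0 => t; exact: Rabs_pos.
have [N NP] := le_v dl dl0.
have e0 : 0 < dl / (F + 1) by apply: Rdiv_lt_0_compat; lra.
have [n [Nn nP]] := clP _ e0 N.
have := NP n Nn.
have : rsum (fun t => P t * f t) - rsum (fun t => Q n t * f t) <= dl / (F + 1) * F.
  rewrite -rsumB -rsumMl; apply: rsum_le => t.
  rewrite -Rmult_minus_distr_r; apply: (Rle_trans _ _ _ (Rle_abs _)).
  rewrite Rabs_mult; apply: Rmult_le_compat_r; first exact: Rabs_pos.
  by rewrite Rabs_minus_sym; apply/Rlt_le.
have : dl / (F + 1) * F < dl.
  apply: (Rmult_lt_reg_r (F + 1)); first lra.
  by rewrite (_ : _ * (F + 1) = dl * F); [nra | field; lra].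
have : 2 * dl = rsum (fun t => P t * f t) - v by rewrite /dl; field.
lra.
Qed.

(** [up x] overshoots an integer [x] by exactly 1, hence the two cases; positivity keeps [Z.to_nat]
    from truncating. *)
Lemma ceilR_bounds x : 0 < x -> x <= INR (ceilR x) <= x + 1.
Proof.
move=> x0; have [up1 up2] := archimed x; rewrite /ceilR.
case: (Req_dec_T (IZR (up x) - 1) x) => [xE|xN] /=; rewrite INR_IZR_INZ Znat.Z2Nat.id.
- by rewrite minus_IZR; lra.
- by apply: le_IZR; rewrite minus_IZR; lra.
- lra.
- by apply: le_IZR; lra.
Qed.

Lemma code_size_bounds n r :
  exp (INR n * r * ln 2) <= INR (code_size n r) <= exp (INR n * r * ln 2) + 1.
Proof. exact/ceilR_bounds/exp_pos. Qed.

Lemma code_size_gt0 n r : 0 < INR (code_size n r).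
Proof. by have := code_size_bounds n r; have := exp_pos (INR n * r * ln 2); lra. Qed.

(** * Expectations under the law of a code, and the information bound of the converse *)

Section CodeExpectation.
Variables (X : finType) (mu : X -> R) (n : nat) (Rr Rc : R).
Variables (enc : encoder X n Rr Rc) (dec : decoder X n Rr Rc).
Hypotheses (mu_pmf : is_pmf mu) (code_ok : valid_code enc dec).
Local Notation K := (code_size n Rc).
Local Notation M := (code_size n Rr).
Local Notation expect := (code_expect mu enc dec).

Let law_ge0 x k j y : 0 <= iid mu x * / INR K * enc x k j * dec j k y.
Proof.
have [encP decP] := code_ok; have [I0 _] := iid_pmf n mu_pmf.
apply: Rmult_le_pos; last exact: (proj1 (decP j k)).
apply: Rmult_le_pos; last exact: (proj1 (encP x k)).
apply: Rmult_le_pos; first exact: I0.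
by apply/Rlt_le/Rinv_0_lt_compat/code_size_gt0.
Qed.

Lemma code_expect_le g h :
  (forall x k j y, g x k j y <= h x k j y) -> expect g <= expect h.
Proof.
move=> gh; do 4!(apply: rsum_le => ?).
by apply: Rmult_le_compat_l; [exact: law_ge0 | exact: gh].
Qed.

Lemma code_expect_rsum (T : finType) (g : T -> _) (f : T -> R) :
  rsum (fun t => expect (g t) * f t) =
  expect (fun x k j y => rsum (fun t => g t x k j y * f t)).
Proof.
rewrite /code_expect.
under eq_rsum => t do rewrite -rsumMr.
rewrite exchange_rsum; apply: eq_rsum => x.
under eq_rsum => t do rewrite -rsumMr.
rewrite exchange_rsum; apply: eq_rsum => k.
under eq_rsum => t do rewrite -rsumMr.
rewrite exchange_rsum; apply: eq_rsum => j.
under eq_rsum => t do rewrite -rsumMr.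
rewrite exchange_rsum; apply: eq_rsum => y.
by rewrite -rsumMl; apply: eq_rsum => t; rewrite Rmult_assoc.
Qed.

Lemma code_expectMl a g : expect (fun x k j y => a * g x k j y) = a * expect g.
Proof.
rewrite -rsumMl; apply: eq_rsum => x; rewrite -rsumMl; apply: eq_rsum => k.
rewrite -rsumMl; apply: eq_rsum => j; rewrite -rsumMl; apply: eq_rsum => y; ring.
Qed.

Lemma code_expectD g h :
  expect (fun x k j y => g x k j y + h x k j y) = expect g + expect h.
Proof.
rewrite -rsumD; apply: eq_rsum => x; rewrite -rsumD; apply: eq_rsum => k.
rewrite -rsumD; apply: eq_rsum => j; rewrite -rsumD; apply: eq_rsum => y; ring.
Qed.

Lemma code_expect_source f :
  expect (fun x _ _ _ => f x) = rsum (fun x => iid mu x * f x).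
Proof.
have [encP decP] := code_ok; apply: eq_rsum => x.
transitivity (rsum (fun _ : 'I_K => iid mu x * f x * / INR K)); last first.
  by rewrite rsum_const card_ord; field; have := code_size_gt0 n Rc; lra.
apply: eq_rsum => k; rewrite -[RHS]Rmult_1_r -(proj2 (encP x k)) -rsumMl.
apply: eq_rsum => j; rewrite -[RHS]Rmult_1_r -(proj2 (decP j k)) -rsumMl.
by apply: eq_rsum => y; ring.
Qed.

Lemma code_expect_const a : expect (fun _ _ _ _ => a) = a.
Proof.
by rewrite (code_expect_source (fun _ => a)) rsumMr (proj2 (iid_pmf n mu_pmf)); ring.
Qed.

(* Bounding the encoder by 1 makes J independent of X^n at the price of a factor M. *)
Lemma code_expect_le_size (g : n.-tuple X -> n.-tuple X -> R) :
  (forall x y, 0 <= g x y) -> (forall y, rsum (fun x => iid mu x * g x y) <= 1) ->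
  expect (fun x _ _ y => g x y) <= INR M.
Proof.
move=> g0 g1; have [encP decP] := code_ok; have [I0 _] := iid_pmf n mu_pmf.
have K0 := code_size_gt0 n Rc; have iK0 := Rinv_0_lt_compat _ K0.
apply: (@Rle_trans _ (rsum (fun x => rsum (fun k => rsum (fun j => rsum (fun y =>
    (/ INR K * dec j k y) * (iid mu x * g x y))))))).
  apply: rsum_le => x; apply: rsum_le => k; apply: rsum_le => j; apply: rsum_le => y.
  rewrite (_ : _ * g x y =
    enc x k j * (/ INR K * dec j k y * (iid mu x * g x y))); last by ring.
  rewrite -[X in _ <= X]Rmult_1_l; apply: Rmult_le_compat_r.
    apply: Rmult_le_pos; last exact: Rmult_le_pos.
    by apply: Rmult_le_pos; [lra | exact: (proj1 (decP j k))].
  exact: pmf_le1.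
rewrite exchange_rsum.
apply: (@Rle_trans _ (rsum (fun k : 'I_K => / INR K * INR M))); last first.
  by rewrite rsum_const card_ord; apply: Req_le; field; lra.
apply: rsum_le => k; rewrite exchange_rsum.
apply: (@Rle_trans _ (rsum (fun j : 'I_M => / INR K))); last first.
  by rewrite rsum_const card_ord; lra.
(* For fixed [y] the source sum is at most 1, and then the decoder sums to 1: each message
   contributes one unit, averaged over the key. *)
apply: rsum_le => j; rewrite exchange_rsum -[X in _ <= X]Rmult_1_r.
rewrite -(proj2 (decP j k)) -rsumMl; apply: rsum_le => y.
rewrite rsumMl -[X in _ <= X]Rmult_1_r; apply: Rmult_le_compat_l; last exact: g1.
by apply: Rmult_le_pos; [lra | exact: (proj1 (decP j k))].
Qed.

(** Apply [ln t <= t - 1] to [t = g / M], where [g] is the product of [r] over coordinates. For each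
    output word [g] has source mean at most 1, so its expectation under the code is at most [M]. *)
Lemma code_info_le (r : X -> X -> R) :
  (forall a b, 0 < r a b) -> (forall b, rsum (fun a => mu a * r a b) <= 1) ->
  expect (fun x _ _ y => rsum (fun i => ln (r (tnth x i) (tnth y i)))) <= ln (INR M).
Proof.
move=> r0 r1; have M0 := code_size_gt0 n Rr; have iM0 := Rinv_0_lt_compat _ M0.
pose g (x y : n.-tuple X) := \big[Rmult/1]_(i < n) r (tnth x i) (tnth y i).
have g0 x y : 0 < g x y by apply: prod_gt0 => i.
apply: (@Rle_trans _ (expect (fun x _ _ y => / INR M * g x y + (ln (INR M) - 1)))).
  apply: code_expect_le => x _ _ y; rewrite -ln_prod // -/(g x y).
  have := ln_le_sub1 (Rmult_lt_0_compat _ _ iM0 (g0 x y)).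
  by rewrite ln_mult // ln_Rinv //; lra.
rewrite (code_expectD (fun x _ _ y => / INR M * g x y) (fun _ _ _ _ => ln (INR M) - 1)).
rewrite code_expect_const (code_expectMl (/ INR M) (fun x _ _ y => g x y)).
have : expect (fun x _ _ y => g x y) <= INR M.
  apply: code_expect_le_size => [x y|y]; first exact/Rlt_le.
  rewrite /iid /g; under eq_rsum => x do rewrite -big_split /=.
  rewrite (rsum_tuple_prod (fun i a => mu a * r a (tnth y i))).
  apply: prod_le1 => i; split; last exact: r1.
  apply: rsum_ge0 => a; apply: Rmult_le_pos; first exact: (proj1 mu_pmf).
  exact/Rlt_le.
move=> /(Rmult_le_compat_l _ _ _ (Rlt_le _ _ iM0)); rewrite Rinv_l; lra.
Qed.

(** For [n > 0], the joint law of source and output letters at a uniformly random time. *)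
Definition mean_emp (c : X * X) : R := expect (fun x _ _ y => emp [tuple of zip x y] c).

Lemma mean_emp_rsum (f : X * X -> R) : rsum (fun c => mean_emp c * f c) =
  expect (fun x _ _ y => / INR n * rsum (fun i => f (tnth x i, tnth y i))).
Proof.
rewrite (code_expect_rsum (fun c x _ _ y => emp [tuple of zip x y] c)).
do 4!(apply: eq_rsum => ?); congr (_ * _); rewrite emp_mean; congr (_ * _).
by apply: eq_rsum => i; rewrite tnth_zip.
Qed.

Lemma mean_emp_bounds c : (0 < n)%nat -> 0 <= mean_emp c <= 1.
Proof.
move=> n0; rewrite -[X in X <= _ <= _](code_expect_const 0).
rewrite -[X in _ <= _ <= X](code_expect_const 1); split; apply: code_expect_le => x _ _ y.
  exact: emp_ge0.
exact/pmf_le1/emp_pmf.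
Qed.

(** Every source letter has law [mu] whatever the code, so this marginal is exact at each length,
    while the output marginal is controlled only asymptotically. *)
Lemma mean_emp_fst a : (0 < n)%nat ->
  rsum (fun c => mean_emp c * indic (a == c.1)) = mu a.
Proof.
move=> n0; rewrite mean_emp_rsum.
rewrite (code_expect_source (fun x => / INR n * rsum (fun i => indic (a == tnth x i)))).
under eq_rsum => x do rewrite (Rmult_comm (/ _)) -Rmult_assoc -rsumMl.
rewrite rsumMr exchange_rsum.
have E (i : 'I_n) : rsum (fun x : n.-tuple X => iid mu x * indic (a == tnth x i)) = mu a.
  rewrite (iid_mean mu_pmf (fun t => indic (a == t))) -[RHS](rsum_delta a mu).
  by apply: eq_rsum => t; rewrite (eq_sym a t) Rmult_comm.
under eq_rsum => i do rewrite E.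
rewrite rsum_const card_ord; field.
by apply: not_0_INR => n00; rewrite n00 in n0.
Qed.

End CodeExpectation.

(** * Density of a coupling with respect to the product of its marginals *)

Section InformationDensity.
Variables (X : finType) (mu psi : X -> R) (P : X * X -> R).
Hypotheses (mu_pmf : is_pmf mu) (psi_pmf : is_pmf psi) (P_ge0 : forall c, 0 <= P c).
Hypothesis P_fst : forall a, rsum (fun b => P (a, b)) = mu a.
Hypothesis P_snd : forall b, rsum (fun a => P (a, b)) = psi b.

(** The Radon-Nikodym derivative. A coupling vanishes wherever the product of its marginals does,
    and there the value is 0. *)
Definition density (c : X * X) : R := P c / (mu c.1 * psi c.2).

Lemma coupling_pos c : 0 < P c -> 0 < mu c.1 /\ 0 < psi c.2.
Proof.
case: c => a b P0; split=> /=.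
  rewrite -P_fst; apply: Rlt_le_trans P0 _.
  exact: (le_rsum b (fun b' => P_ge0 (a, b'))).
rewrite -P_snd; apply: Rlt_le_trans P0 _.
exact: (le_rsum a (fun a' => P_ge0 (a', b))).
Qed.

Lemma densityK c : P c = mu c.1 * psi c.2 * density c.
Proof.
have [P0|P0] : 0 < P c \/ P c = 0 by have := P_ge0 c; lra.
  by have [m0 p0] := coupling_pos P0; rewrite /density; field; lra.
by rewrite /density P0 /Rdiv Rmult_0_l Rmult_0_r.
Qed.

Lemma density_gt0 c : 0 < P c -> 0 < density c.
Proof.
move=> P0; have [m0 p0] := coupling_pos P0.
by apply: Rdiv_lt_0_compat P0 _; apply: Rmult_lt_0_compat.
Qed.

Lemma density_ge0 c : 0 <= density c.
Proof.
have [/density_gt0|P0] : 0 < P c \/ P c = 0 by have := P_ge0 c; lra.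
  exact: Rlt_le.
by rewrite /density P0 /Rdiv Rmult_0_l; lra.
Qed.

Lemma mutual_infoE : mutual_info P = rsum (fun c => P c * ln (density c)) / ln 2.
Proof.
rewrite /Rdiv -rsumMr; apply: eq_rsum => c; rewrite P_fst P_snd.
case: (Req_dec_T (P c) 0) => [P0|_] /=; first by rewrite P0; ring.
by rewrite /log2 /Rdiv -/(density c) Rmult_assoc.
Qed.

(** The sum is the total mass of the conditional law given [b] if [psi b > 0], and 0 otherwise. This
    is the normalization that [code_info_le] asks of a test function. *)
Lemma density_snd_le1 b : rsum (fun a => mu a * density (a, b)) <= 1.
Proof.
apply: (@Rle_trans _ (rsum (fun a => P (a, b) * / psi b))).
  apply: rsum_le => a; rewrite /density /=.
  have [m0|m0] : 0 < mu a \/ mu a = 0 by have := proj1 mu_pmf a; lra.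
    rewrite /Rdiv Rinv_mult (_ : mu a * _ = mu a * / mu a * (P (a, b) * / psi b)).
      by rewrite Rinv_r; lra.
    by ring.
  rewrite m0 Rmult_0_l; apply: Rmult_le_pos; first exact: P_ge0.
  case: (proj1 psi_pmf b) => [p0|<-]; first exact/Rlt_le/Rinv_0_lt_compat.
  by rewrite Rinv_0; lra.
rewrite rsumMr P_snd; have [p0|<-] := proj1 psi_pmf b.
  by rewrite Rinv_r; lra.
by rewrite Rinv_0; lra.
Qed.

End InformationDensity.

Lemma ln2_gt0 : 0 < ln 2.
Proof. by rewrite -ln_1; apply: ln_increasing; lra. Qed.

Lemma ln_le (a b : R) : 0 < a -> a <= b -> ln a <= ln b.
Proof.
by move=> a0 [ab|<-]; [apply/Rlt_le/ln_increasing | exact: Rle_refl].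
Qed.

Lemma Rle_plus_eps (a b : R) : (forall eps, 0 < eps -> a <= b + eps) -> a <= b.
Proof.
by move=> ab; apply: Rnot_lt_le => ba; have := ab ((a - b) / 2) ltac:(lra); lra.
Qed.

Lemma inv_nat_eventually_lt (eps : R) : 0 < eps ->
  exists N : nat, forall n : nat, (N <= n)%nat -> / INR n.+1 < eps.
Proof.
move=> eps0; have [N [Neps N0]] := archimed_cor1 eps eps0.
exists N => n Nn; apply: Rlt_trans Neps; apply: Rinv_lt_contravar.
  by apply: Rmult_lt_0_compat; apply: lt_0_INR => //; apply/ltP.
by apply: lt_INR; apply/ltP.
Qed.

(** Turns convergence in probability into convergence of mean frequencies: a deviation is at most
    twice the total variation, and at most 1 on the bad event. *)
Lemma emp_tv_le (T : finType) n (y : n.-tuple T) (psi : T -> R) b eps :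
  (0 < n)%nat -> is_pmf psi -> 0 <= eps ->
  Rabs (emp y b - psi b) <= 2 * eps + (if Rlt_dec eps (tv (emp y) psi) then 1 else 0).
Proof.
move=> n0 psi_pmf eps0; have yP := emp_pmf y n0.
case: (Rlt_dec eps _) => [_|/Rnot_lt_le] /=.
  have := proj1 yP b; have := pmf_le1 b yP.
  have := proj1 psi_pmf b; have := pmf_le1 b psi_pmf.
  by move=> *; apply: Rabs_le; lra.
rewrite /tv => tv_le; apply: Rle_trans (le_rsum b (fun v => Rabs_pos (emp y v - psi v))) _.
lra.
Qed.

Lemma achievable_rate_set (X : finType) (d : X -> X -> R) (p : R) (mu psi : X -> R)
  (D Rr Rc : R) : is_pmf mu -> is_pmf psi -> 0 <= Rr ->
  emp_achievable d p mu psi D Rr Rc -> rate_set d p mu psi D Rr.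
Proof.
move=> mu_pmf psi_pmf Rr0 [enc [dec [code_ok [dist_le tv_cv]]]].
(* The shift to [n.+1] avoids the empty word, whose empirical distribution is not a probability. *)
pose Q n := mean_emp mu (enc n.+1) (dec n.+1).
have [P clP] : exists P : X * X -> R, forall eps, 0 < eps -> forall N : nat,
    exists n, (N <= n)%nat /\ forall t, Rabs (Q n t - P t) < eps.
  by apply: cluster_point => n t; apply: mean_emp_bounds.
have P_le f v := @cluster_le _ Q P f v clP.
have P_ge0 c : 0 <= P c.
  (* Only upper bounds pass to the cluster point, so nonnegativity is tested against minus an
     indicator; the lower bounds on marginals below use the same sign change. *)
  suff : rsum (fun c' => P c' * - indic (c' == c)) <= 0.
    rewrite (_ : rsum _ = - P c); first by lra.
    rewrite -[P c](rsum_delta c P) -[in RHS](Rmult_1_l (rsum _)) Ropp_mult_distr_l.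
    by rewrite -rsumMl; apply: eq_rsum => c'; ring.
  apply: P_le => eps eps0; exists 0%nat => n _; apply: (@Rle_trans _ (rsum (fun _ => 0))).
    apply: rsum_le => c'; have [+ _] := mean_emp_bounds mu_pmf (code_ok n.+1) c' (ltn0Sn n).
    by rewrite -/(Q n c'); have := indic_bounds (c' == c); nra.
  by rewrite rsum_const; lra.
have P_fst a : rsum (fun b => P (a, b)) = mu a.
  have Q_fst n := mean_emp_fst mu_pmf (code_ok n.+1) a (ltn0Sn n).
  rewrite -marginal_fst; apply: Rle_antisym.
    by apply: P_le => eps eps0; exists 0%nat => n _; rewrite Q_fst; lra.
  suff : rsum (fun c => P c * (-1 * indic (a == c.1))) <= - mu a.
    by under eq_rsum => c do [rewrite (Rmult_comm (-1)) -Rmult_assoc]; rewrite rsumMr; lra.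
  apply: P_le => eps eps0; exists 0%nat => n _.
  under eq_rsum => c do [rewrite (Rmult_comm (-1)) -Rmult_assoc].
  by rewrite rsumMr Q_fst; lra.
have Q_snd b eps : 0 < eps -> exists N : nat, forall n, (N <= n)%nat ->
    Rabs (rsum (fun c => Q n c * indic (b == c.2)) - psi b) <= eps.
  (* The threshold [eps / 4] costs [eps / 2] through [emp_tv_le]; the bad event costs another
     [eps / 2]. *)
  move=> eps0; have e4 : 0 < eps / 4 by lra.
  have [N NP] := tv_cv _ e4 (eps / 2) ltac:(lra).
  exists N => n Nn; have {NP} := NP n.+1 (leP (leqW Nn)).
  rewrite /R_dist Rminus_0_r => /(Rle_lt_trans _ _ _ (Rle_abs _)) tv_lt.
  rewrite mean_emp_rsum.
  pose h (y : n.+1.-tuple X) := if Rlt_dec (eps / 4) (tv (emp y) psi) then 1 else 0.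
  (* The sign [s] is 1 for the upper bound and -1 for the lower bound. *)
  have Eh (s : R) : code_expect mu (enc n.+1) (dec n.+1)
      (fun _ _ _ y => psi b + s * (eps / 2 + h y)) = psi b + s * (eps / 2 +
     code_expect mu (enc n.+1) (dec n.+1) (fun _ _ _ y => h y)).
    rewrite (code_expectD mu _ _ (fun _ _ _ _ => psi b)
      (fun _ _ _ y => s * (eps / 2 + h y))).
    rewrite (code_expectMl mu _ _ s (fun _ _ _ y => eps / 2 + h y)).
    rewrite (code_expectD mu _ _ (fun _ _ _ _ => eps / 2) (fun _ _ _ y => h y)).
    by rewrite !code_expect_const.
  have dev (y : n.+1.-tuple X) : Rabs (emp y b - psi b) <= eps / 2 + h y.
    by have := emp_tv_le y b (ltn0Sn n) psi_pmf (Rlt_le _ _ e4); rewrite -/(h y); lra.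
  have lo : psi b + -1 * (eps / 2 + code_expect mu (enc n.+1) (dec n.+1)
      (fun _ _ _ y => h y)) <= code_expect mu (enc n.+1) (dec n.+1)
      (fun x _ _ y => / INR n.+1 * rsum (fun i => indic (b == tnth y i))).
    rewrite -Eh; apply: code_expect_le => // x _ _ y; rewrite -empE.
    by have := dev y; move: (emp y b) (h y) => u v; rewrite /Rabs; case: Rcase_abs; lra.
  have hi : code_expect mu (enc n.+1) (dec n.+1)
      (fun x _ _ y => / INR n.+1 * rsum (fun i => indic (b == tnth y i))) <=
      psi b + 1 * (eps / 2 + code_expect mu (enc n.+1) (dec n.+1) (fun _ _ _ y => h y)).
    rewrite -Eh; apply: code_expect_le => // x _ _ y; rewrite -empE.
    by have := dev y; move: (emp y b) (h y) => u v; rewrite /Rabs; case: Rcase_abs; lra.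
  by move: tv_lt lo hi; rewrite -/h /= => *; apply: Rabs_le; lra.
have P_snd b : rsum (fun a => P (a, b)) = psi b.
  rewrite -marginal_snd; apply: Rle_antisym.
    apply: P_le => eps eps0; have [N NP] := Q_snd b eps eps0; exists N => n Nn.
    by have := Rle_trans _ _ _ (Rle_abs _) (NP n Nn); lra.
  suff : rsum (fun c => P c * (-1 * indic (b == c.2))) <= - psi b.
    by under eq_rsum => c do [rewrite (Rmult_comm (-1)) -Rmult_assoc]; rewrite rsumMr; lra.
  apply: P_le => eps eps0; have [N NP] := Q_snd b eps eps0; exists N => n Nn.
  under eq_rsum => c do [rewrite (Rmult_comm (-1)) -Rmult_assoc].
  rewrite rsumMr; have := NP n Nn; rewrite Rabs_minus_sym.
  by move=> /(Rle_trans _ _ _ (Rle_abs _)); lra.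
exists P; do ![split] => //.
- by rewrite -(proj2 mu_pmf) -(eq_rsum P_fst) rsum_pair; apply: eq_rsum => -[].
- apply: P_le => eps eps0; have [N NP] := dist_le eps eps0; exists N => n Nn.
  rewrite mean_emp_rsum; exact: (NP n.+1 (leqW Nn)).
rewrite (mutual_infoE P_fst P_snd).
have l2 := ln2_gt0; apply: (Rmult_le_reg_r (ln 2)) => //.
rewrite /Rdiv Rmult_assoc Rinv_l ?Rmult_1_r; last by lra.
(* Weight [exp (- eta)] on the density lowers its logarithm by [eta]; [e] is the complementary
   weight, so the mixture stays normalized. *)
apply: Rle_plus_eps => eta eta0; pose e := 1 - exp (- eta).
have e1 : exp (- eta) < 1 by rewrite -exp_0; apply: exp_increasing; lra.
have e0 := exp_pos (- eta).
(* Mixing in the constant density 1 makes the test function log r finite everywhere. *)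
pose r a b := exp (- eta) * density mu psi P (a, b) + e.
have r0 a b : 0 < r a b.
  by have := density_ge0 P_ge0 P_fst P_snd (a, b); rewrite /r /e; nra.
have r1 b : rsum (fun a => mu a * r a b) <= 1.
  rewrite (_ : rsum _ = exp (- eta) * rsum (fun a => mu a * density mu psi P (a, b)) + e).
    by have := density_snd_le1 mu_pmf psi_pmf P_ge0 P_snd b; rewrite /e; nra.
  rewrite -[e in RHS]Rmult_1_l -(proj2 mu_pmf) -rsumMl -rsumMr -rsumD.
  by apply: eq_rsum => a; rewrite /r; ring.
have : rsum (fun c => P c * ln (r c.1 c.2)) <= Rr * ln 2.
  apply: P_le => eps eps0.
  have [N NP] := inv_nat_eventually_lt (Rdiv_lt_0_compat _ _ eps0 l2).
  exists N => n Nn; rewrite mean_emp_rsum /=.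
  have n0 : 0 < INR n.+1 by apply: lt_0_INR; apply/ltP.
  rewrite (code_expectMl mu (enc n.+1) (dec n.+1) (/ INR n.+1)
    (fun x _ _ y => rsum (fun i => ln (r (tnth x i) (tnth y i))))).
  have := code_info_le mu_pmf (code_ok n.+1) r0 r1.
  (* Since the exponent is nonnegative, rounding up at most doubles the number of messages, an
     excess of [ln 2] that vanishes after division by the length. *)
  have : ln (INR (code_size n.+1 Rr)) <= INR n.+1 * Rr * ln 2 + ln 2.
    have E0 : 0 <= INR n.+1 * Rr * ln 2.
      by apply: Rmult_le_pos; [apply: Rmult_le_pos |]; lra.
    have [s1 s2] := code_size_bounds n.+1 Rr.
    rewrite -[X in _ <= X + _]ln_exp -ln_mult; try lra; last exact: exp_pos.
    apply: ln_le; first exact: code_size_gt0.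
    by have := exp_ineq1_le (INR n.+1 * Rr * ln 2); lra.
  move: (code_expect _ _ _ _) => E u v.
  have {u v} : / INR n.+1 * E <= / INR n.+1 * (INR n.+1 * Rr * ln 2 + ln 2).
    by apply: Rmult_le_compat_l; [apply/Rlt_le/Rinv_0_lt_compat | lra].
  have : / INR n.+1 * ln 2 <= eps.
    by rewrite -(Rmult_1_r eps) -(Rinv_l (ln 2)) -?Rmult_assoc; [
      apply: Rmult_le_compat_r; [lra | apply/Rlt_le/NP] | lra].
  rewrite (_ : / INR n.+1 * (_ + _) = Rr * ln 2 + / INR n.+1 * ln 2); last by field; lra.
  lra.
suff : rsum (fun c => P c * ln (density mu psi P c)) + - eta * 1 <=
    rsum (fun c => P c * ln (r c.1 c.2)) by lra.
have <- : rsum P = 1.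
  by rewrite -(proj2 mu_pmf) -(eq_rsum P_fst) rsum_pair; apply: eq_rsum => -[].
rewrite -rsumMl -rsumD; apply: rsum_le => -[a b] /=.
have [P0|P0] : 0 < P (a, b) \/ P (a, b) = 0 by have := P_ge0 (a, b); lra.
  have D0 := density_gt0 P_ge0 P_fst P_snd P0.
  have : - eta + ln (density mu psi P (a, b)) <= ln (r a b).
    rewrite -{1}(ln_exp (- eta)) -ln_mult //; apply: ln_le; first exact: Rmult_lt_0_compat.
    by rewrite /r /e; lra.
  by nra.
by rewrite P0; lra.
Qed.

(** * Achievability *)

(** The probabilistic method: if every value were below the mean, the weighted gaps would be
    nonnegative with sum 0, forcing [q] to vanish. *)
Lemma exists_ge_mean (T : finType) (q f : T -> R) :
  is_pmf q -> exists t, rsum (fun t => q t * f t) <= f t.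
Proof.
move=> [q0 q1]; apply: NNPP => no_t; set c := rsum _ in no_t.
have f_lt t : f t < c by apply: Rnot_le_lt => le; apply: no_t; exists t.
have gap0 : rsum (fun t => q t * (c - f t)) = 0.
  under eq_rsum => t do rewrite Rmult_minus_distr_l.
  by rewrite rsumB rsumMr q1 -/c; ring.
have gap_ge0 t : 0 <= q t * (c - f t).
  by apply: Rmult_le_pos; [exact: q0 | have := f_lt t; lra].
have : rsum q <= rsum (fun _ : T => 0).
  apply: rsum_le => t; have := le_rsum t gap_ge0; rewrite gap0.
  by have := f_lt t; have := q0 t; nra.
by rewrite q1 rsum_const; lra.
Qed.

(* Codewords are added greedily: each new one covers at least the fraction [a] of the
   uncovered mass in excess of the atypical mass. *)
Lemma greedy_covering (A B : finType) (m : A -> R) (q : B -> R) (w : A -> B -> R)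
    (G : A -> B -> bool) (a : R) (M : nat) :
  is_pmf m -> is_pmf q -> (forall x y, 0 <= w x y) -> (forall x, rsum (w x) = m x) ->
  0 <= a <= 1 -> (forall x y, G x y -> a * w x y <= m x * q y) ->
  exists s : M.-tuple B, rsum (fun x => m x * indic (~~ has (G x) s)) <=
    rsum (fun x => rsum (fun y => w x y * indic (~~ G x y))) + (1 - a) ^ M.
Proof.
move=> m_pmf q_pmf w0 w1 a01 aG; set eta := rsum (fun x => rsum _).
elim: M => [|M [s IHs]].
  exists [tuple] => /=; rewrite rsumMr (proj2 m_pmf).
  suff : 0 <= eta by lra.
  by apply: rsum_ge0 => x; apply: rsum_ge0 => y; have := w0 x y; case: (G x y) => /=; lra.
pose U x := indic (~~ has (G x) s).
have U01 x : 0 <= U x <= 1 by exact: indic_bounds.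
have [y y_ge] := exists_ge_mean (fun y => rsum (fun x => m x * U x * indic (G x y))) q_pmf.
exists [tuple of y :: s].
rewrite (_ : rsum _ = rsum (fun x => m x * U x) -
    rsum (fun x => m x * U x * indic (G x y))); last first.
  rewrite -rsumB; apply: eq_rsum => x /=; rewrite /U.
  by case: (G x y) => /=; ring.
(* It suffices to bound the [q]-average of the newly covered mass: the excess of the uncovered mass
   over [eta] then shrinks by the factor [1 - a]. *)
suff : a * (rsum (fun x => m x * U x) - eta) <=
    rsum (fun y => q y * rsum (fun x => m x * U x * indic (G x y))).
  move: IHs; rewrite -/U /= => IHs; move: y_ge.
  set u := rsum (fun x => m x * U x) in IHs *; set v := rsum (fun x => _ * _ * _).
  set z := rsum _ => zv az.
  have : (1 - a) * (u - eta) <= (1 - a) * (1 - a) ^ M by apply: Rmult_le_compat_l; lra.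
  lra.
under [X in _ <= X]eq_rsum => y' do rewrite -rsumMl.
rewrite exchange_rsum /eta -rsumB -rsumMl; apply: rsum_le => x.
(* As [U x <= 1], the mass outside [G] can be subtracted in full; on [G] the joint weight is then
   compared with the product weight. *)
apply: (@Rle_trans _ (U x * rsum (fun y' => a * w x y' * indic (G x y')))).
  apply: (@Rle_trans _ (U x * (a * (m x - rsum (fun y' => w x y' * indic (~~ G x y')))))).
    have : 0 <= rsum (fun y' => w x y' * indic (~~ G x y')).
      by apply: rsum_ge0 => y'; apply: Rmult_le_pos; [exact: w0 | case: (indic_bounds (~~ G x y'))].
    move: (rsum _) => v v0; have := U01 x; have : 0 <= a * v by nra.
    nra.
  apply: Rmult_le_compat_l; first by case: (U01 x).
  rewrite -w1 -rsumB -rsumMl; apply: rsum_le => y'.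
  by case: (G x y') => /=; lra.
rewrite -rsumMl; apply: rsum_le => y'.
rewrite (_ : q y' * _ = U x * (m x * q y' * indic (G x y'))); last by ring.
apply: Rmult_le_compat_l; first by case: (U01 x).
by case: (boolP (G x y')) => [/aG|_] /=; lra.
Qed.

Lemma typical_mean (T : finType) (P f : T -> R) n (z : n.-tuple T) dl :
  typical P dl z ->
  rsum (fun c => emp z c * f c) <= rsum (fun c => P c * f c) + dl * rsum (fun c => Rabs (f c)).
Proof.
move=> /typicalP zP; rewrite -rsumMl -rsumD; apply: rsum_le => c.
suff : (emp z c - P c) * f c <= dl * Rabs (f c) by lra.
apply: (Rle_trans _ _ _ (Rle_abs _)); rewrite Rabs_mult.
by apply: Rmult_le_compat_r; [exact: Rabs_pos | exact: zP].
Qed.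

Lemma iid_zip (X Y : finType) (mu : X -> R) (psi : Y -> R) n (x : n.-tuple X) (y : n.-tuple Y) :
  iid (fun c => mu c.1 * psi c.2) [tuple of zip x y] = iid mu x * iid psi y.
Proof.
by rewrite /iid -big_split; apply: eq_bigr => i _; rewrite tnth_zip.
Qed.

Lemma iid_fst (X : finType) (mu : X -> R) (P : X * X -> R) n (x : n.-tuple X) :
  (forall a, rsum (fun b => P (a, b)) = mu a) ->
  rsum (fun y : n.-tuple X => iid P [tuple of zip x y]) = iid mu x.
Proof.
move=> P_fst; rewrite /iid; under eq_rsum => y do under eq_bigr => i _ do rewrite tnth_zip.
rewrite (rsum_tuple_prod (fun i b => P (tnth x i, b))).
by apply: eq_bigr => i _; rewrite P_fst.
Qed.

(** The logarithm of the likelihood ratio of a zipped word is [n] times the empirical mean of the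
    log-density, which on typical words is at most [t]. This is the comparison needed in
    [greedy_covering], with [a = exp (- (n t))]. *)
Lemma typical_iid_le (X : finType) (mu psi : X -> R) (P : X * X -> R) n
    (x y : n.-tuple X) dl t : (0 < n)%nat ->
  (forall a, 0 <= mu a) -> (forall b, 0 <= psi b) -> (forall c, 0 <= P c) ->
  (forall a, rsum (fun b => P (a, b)) = mu a) ->
  (forall b, rsum (fun a => P (a, b)) = psi b) ->
  rsum (fun c => P c * ln (density mu psi P c)) +
    dl * rsum (fun c => Rabs (ln (density mu psi P c))) <= t ->
  typical P dl [tuple of zip x y] ->
  exp (- (INR n * t)) * iid P [tuple of zip x y] <= iid mu x * iid psi y.
Proof.
move=> n_gt0 mu0 psi0 P0 P_fst P_snd t_ge typ; set z := [tuple of zip x y].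
have n0 : 0 < INR n by apply: lt_0_INR; apply/ltP.
have [z0|z0] : 0 < iid P z \/ iid P z = 0.
- have : 0 <= iid P z by apply: prod_ge0 => i.
  lra.
- have r0 i : 0 < density mu psi P (tnth z i).
    by apply: density_gt0 => //; exact: iid_gt0 z0.
  have zE : iid P z = iid mu x * iid psi y *
      exp (rsum (fun i => ln (density mu psi P (tnth z i)))).
    rewrite -ln_prod // exp_ln; last exact: prod_gt0.
    rewrite -iid_zip /iid -big_split; apply: eq_bigr => i _.
    exact: (densityK P0 P_fst P_snd).
  have I0 : 0 <= iid mu x * iid psi y.
    by apply: Rmult_le_pos; apply: prod_ge0 => i.
  rewrite zE (_ : exp _ * _ = iid mu x * iid psi y * (exp (- (INR n * t)) *
    exp (rsum (fun i => ln (density mu psi P (tnth z i)))))); last by ring.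
  rewrite -[X in _ <= X]Rmult_1_r; apply: Rmult_le_compat_l => //.
  rewrite -exp_plus -exp_0; set s := rsum _.
  suff : s <= INR n * t.
    by case=> [lt|->]; [apply/Rlt_le/exp_increasing | apply/Req_le; congr exp]; lra.
  have := Rle_trans _ _ _ (typical_mean (fun c => ln (density mu psi P c)) typ) t_ge.
  rewrite emp_mean -/s => /(Rmult_le_compat_l _ _ _ (Rlt_le _ _ n0)).
  by rewrite -Rmult_assoc Rinv_r ?Rmult_1_l //; lra.
by rewrite z0 Rmult_0_r; apply: Rmult_le_pos; apply: prod_ge0 => i.
Qed.

Lemma indic_pmf (T : finType) (t0 : T) : is_pmf (fun t => indic (t == t0)).
Proof.
split=> [t|]; first by case: (indic_bounds (t == t0)).
by rewrite -(rsum_delta t0 (fun _ => 1)); apply: eq_rsum => t; ring.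
Qed.

(** * Codes with a deterministic encoder that ignore the key *)

Section DeterministicEncoder.
Variables (X : finType) (mu : X -> R) (n : nat) (Rr Rc : R).
Variables (f : n.-tuple X -> 'I_(code_size n Rr)).
Variable W : 'I_(code_size n Rr) -> n.-tuple X -> R.
Hypothesis W_pmf : forall j, is_pmf (W j).

Definition det_encoder : encoder X n Rr Rc := fun x _ j => indic (j == f x).
Definition keyless_decoder : decoder X n Rr Rc := fun j _ => W j.

Lemma det_code_ok : valid_code det_encoder keyless_decoder.
Proof. by split=> [x k|j k]; [exact: (indic_pmf (f x)) | exact: W_pmf]. Qed.

Lemma det_code_expect (g : n.-tuple X -> n.-tuple X -> R) :
  code_expect mu det_encoder keyless_decoder (fun x _ _ y => g x y) =
  rsum (fun x => iid mu x * rsum (fun y => W (f x) y * g x y)).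
Proof.
apply: eq_rsum => x; set v := rsum (fun y => W (f x) y * _).
transitivity (rsum (fun _ : 'I_(code_size n Rc) => / INR (code_size n Rc) * (iid mu x * v))).
  apply: eq_rsum => k.
  rewrite -(rsum_delta (f x) (fun j => _ * (_ * rsum (fun y => W j y * g x y)))).
  apply: eq_rsum => j; rewrite -!rsumMl; apply: eq_rsum => y.
  rewrite /det_encoder /keyless_decoder -!Rmult_assoc; congr (_ * _ * _).
  by rewrite Rmult_assoc [RHS]Rmult_comm (Rmult_comm (/ _)).
by rewrite rsum_const card_ord; field; have := code_size_gt0 n Rc; lra.
Qed.

End DeterministicEncoder.

Lemma code_index0 n r : 'I_(code_size n r).
Proof.
apply: (@Ordinal _ 0); case: (code_size n r) (code_size_gt0 n r) => //=; lra.
Qed.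

Lemma rho_ge0 (X : Type) (d : X -> X -> R) p a b : 0 <= rho d p a b.
Proof.
by rewrite /rho /rpow; case: Rle_dec => _ /=; [lra | exact/Rlt_le/exp_pos].
Qed.

Definition atypical_prob (X : finType) (mu : X -> R) (P : X * X -> R) (dl : R) n Rr Rc
    (enc : encoder X n Rr Rc) (dec : decoder X n Rr Rc) : R :=
  code_expect mu enc dec (fun x _ _ y => indic (~~ typical P dl [tuple of zip x y])).

Lemma one_over_n_eventually_le (a eps : R) : 0 <= a -> 0 < eps ->
  exists N : nat, forall n : nat, (N <= n)%nat -> (0 < n)%nat /\ a * / INR n <= eps.
Proof.
move=> a0 eps0; have e0 : 0 < eps / (a + 1) by apply: Rdiv_lt_0_compat; lra.
have [N NP] := inv_nat_eventually_lt e0; exists N.+1 => -[//|n] Nn; split=> //.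
have n0 : 0 < / INR n.+1 by apply/Rinv_0_lt_compat/lt_0_INR/ltP.
have : (a + 1) * / INR n.+1 <= (a + 1) * (eps / (a + 1)).
  by apply: Rmult_le_compat_l; [lra | exact/Rlt_le/NP].
rewrite (_ : (a + 1) * (eps / (a + 1)) = eps); last by field; lra.
lra.
Qed.

(** * Codes whose source and output words are jointly typical with high probability *)

Section Codes.
Variables (X : finType) (mu psi : X -> R) (Rr Rc : R).
Hypotheses (mu_pmf : is_pmf mu) (psi_pmf : is_pmf psi).

(** With [t] strictly between the information and the rate in nats, typicality costs at most
    [exp (n t)] in likelihood, while the number of codewords exceeds this exponentially. The
    tolerance must fit into the gap [t - I], so [dl] may have to be smaller than [dl0]. *)
Lemma covering_code (P : X * X -> R) : is_pmf P ->
  (forall a, rsum (fun b => P (a, b)) = mu a) ->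
  (forall b, rsum (fun a => P (a, b)) = psi b) ->
  0 < Rr -> rsum (fun c => P c * ln (density mu psi P c)) < Rr * ln 2 ->
  forall dl0, 0 < dl0 -> exists dl, 0 < dl <= dl0 /\ exists N : nat, forall n, (N <= n)%nat ->
    exists (enc : encoder X n Rr Rc) (dec : decoder X n Rr Rc),
      valid_code enc dec /\ atypical_prob mu P dl enc dec <= dl.
Proof.
move=> P_pmf P_fst P_snd Rr0 I_lt dl0 dl00; have [P0 _] := P_pmf.
set I := rsum _ in I_lt; set L := rsum (fun c => Rabs (ln (density mu psi P c))).
have L0 : 0 <= L by apply: rsum_ge0 => c; exact: Rabs_pos.
have R2 : 0 < Rr * ln 2 by apply: Rmult_lt_0_compat; [lra | exact: ln2_gt0].
have [t [t0 tI tR]] : exists t, [/\ 0 <= t, I < t & t < Rr * ln 2].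
  (* Clipping at 0 ensures that [exp (- (n t))] is at most 1. *)
  exists ((Rmax I 0 + Rr * ln 2) / 2).
  have := Rmax_l I 0; have := Rmax_r I 0.
  by have : Rmax I 0 < Rr * ln 2 by [exact: Rmax_lub_lt]; split; lra.
pose dl := Rmin dl0 ((t - I) / (L + 1)).
have dl_gt0 : 0 < dl by apply: Rmin_glb_lt => //; apply: Rdiv_lt_0_compat; lra.
have dlL : I + dl * L <= t.
  have : dl * (L + 1) <= (t - I) / (L + 1) * (L + 1).
    by apply: Rmult_le_compat_r; [lra | exact: Rmin_r].
  rewrite (_ : _ / _ * _ = t - I); last by field; lra.
  lra.
exists dl; split; first by split=> //; exact: Rmin_l.
pose gam := Rr * ln 2 - t; have gam0 : 0 < gam by rewrite /gam; lra.
(* Divided by [n], the first term is the weak-law bound and the second bounds the uncovered mass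
   left by the greedy codebook. *)
pose A := INR #|{: X * X}| / dl ^ 2 + / gam.
have A0 : 0 <= A.
  apply: Rplus_le_le_0_compat; last exact/Rlt_le/Rinv_0_lt_compat.
  by apply: Rle_mult_inv_pos; [exact: pos_INR | nra].
have [N NP] := one_over_n_eventually_le A0 dl_gt0; exists N => n Nn.
have [n_gt0 A_le] := NP n Nn; have n0 : 0 < INR n by apply: lt_0_INR; apply/ltP.
pose G (x y : n.-tuple X) := typical P dl [tuple of zip x y].
pose a := exp (- (INR n * t)); have a0 : 0 < a := exp_pos _.
have a1 : a <= 1.
  have [nt|nt] : 0 < INR n * t \/ INR n * t = 0 by have := Rmult_le_pos _ _ (Rlt_le _ _ n0) t0; lra.
    by apply/Rlt_le; rewrite -exp_0; apply: exp_increasing; lra.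
  by rewrite /a nt Ropp_0 exp_0; lra.
have [s sP] := greedy_covering (code_size n Rr) (iid_pmf n mu_pmf) (iid_pmf n psi_pmf)
  (fun x y => prod_ge0 (fun i => P0 (tnth [tuple of zip x y] i)))
  (fun x => iid_fst x P_fst) (conj (Rlt_le _ _ a0) a1)
  (fun x y => @typical_iid_le _ _ _ _ _ x y _ _ n_gt0 (proj1 mu_pmf) (proj1 psi_pmf)
     P0 P_fst P_snd dlL).
(* The default index is sent only for source words that no codeword covers. *)
pose f x := odflt (code_index0 n Rr) [pick j | G x (tnth s j)].
pose W j (y : n.-tuple X) := indic (y == tnth s j).
have W_pmf j : is_pmf (W j) by exact: indic_pmf.
exists (det_encoder f), (keyless_decoder W); split; first exact: det_code_ok.
rewrite /atypical_prob (det_code_expect mu Rc f W (fun x y => indic (~~ G x y))).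
apply: (@Rle_trans _ (rsum (fun x => iid mu x * indic (~~ has (G x) s)))).
  apply: rsum_le => x; rewrite (rsum_delta (tnth s (f x)) (fun y => indic (~~ G x y))).
  apply: Rmult_le_compat_l; first exact: (proj1 (iid_pmf n mu_pmf)).
  case: (boolP (has (G x) s)) => [/hasP[y /tnthP[j ->]] Gj|_] /=; last first.
    by case: (indic_bounds (~~ G x (tnth s (f x)))).
  by rewrite /f; case: pickP => [j' /= ->|/(_ j)] /=; [lra | rewrite Gj].
apply: (Rle_trans _ _ _ sP); apply: Rle_trans A_le.
rewrite (rsum_zip (fun z : n.-tuple (X * X) => iid P z * indic (~~ typical P dl z))).
rewrite Rmult_plus_distr_r; apply: Rplus_le_compat.
  apply: (Rle_trans _ _ _ (weak_law P_pmf n_gt0 dl_gt0)).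
  by apply: Req_le; rewrite /Rdiv Rinv_mult (Rmult_comm (/ INR n)) Rmult_assoc.
have [M1 _] := code_size_bounds n Rr; set M := code_size n Rr in M1 *.
(* The uncovered term is at most [exp (- (M a))], and [M a >= exp (n gam) >= n gam], so it is at
   most [1 / (n gam)]. *)
have pow_le : (1 - a) ^ M <= exp (- a) ^ M.
  by apply: pow_incr; split; [lra | have := exp_ineq1_le (- a); lra].
apply: (Rle_trans _ _ _ pow_le).
have -> : exp (- a) ^ M = exp (- (INR M * a)).
  elim: M {M1 pow_le} => [|M IHM]; first by rewrite /= Rmult_0_l Ropp_0 exp_0.
  by rewrite [_ ^ _]/= IHM -exp_plus S_INR; congr exp; ring.
have Ma : INR n * gam <= INR M * a.
  apply: (@Rle_trans _ (exp (INR n * Rr * ln 2) * a)); last first.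
    by apply: Rmult_le_compat_r => //; lra.
  rewrite /a -exp_plus; have := exp_ineq1_le (INR n * gam).
  rewrite (_ : INR n * Rr * ln 2 + _ = INR n * gam); last by rewrite /gam; ring.
  lra.
have ng0 : 0 < INR n * gam by exact: Rmult_lt_0_compat.
rewrite exp_Ropp -Rinv_mult (Rmult_comm gam); apply: Rinv_le_contravar => //.
have := exp_ineq1_le (INR M * a); lra.
Qed.

(** A constant message and an independent i.i.d. output make the zipped word i.i.d. with law [P], so
    the weak law applies directly. *)
Lemma product_code (P : X * X -> R) : (forall c, P c = mu c.1 * psi c.2) -> is_pmf P ->
  forall dl, 0 < dl -> exists N : nat, forall n, (N <= n)%nat ->
    exists (enc : encoder X n Rr Rc) (dec : decoder X n Rr Rc),
      valid_code enc dec /\ atypical_prob mu P dl enc dec <= dl.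
Proof.
move=> PE P_pmf dl dl0.
have A0 : 0 <= INR #|{: X * X}| / dl ^ 2.
  by apply: Rle_mult_inv_pos; [exact: pos_INR | nra].
have [N NP] := one_over_n_eventually_le A0 dl0; exists N => n Nn.
have [n_gt0 A_le] := NP n Nn; have n0 : 0 < INR n by apply: lt_0_INR; apply/ltP.
pose f (_ : n.-tuple X) := code_index0 n Rr.
pose W (_ : 'I_(code_size n Rr)) : n.-tuple X -> R := @iid X psi n.
have W_pmf j : is_pmf (W j) by exact: iid_pmf.
exists (det_encoder f), (keyless_decoder W); split; first exact: det_code_ok.
rewrite /atypical_prob.
rewrite (det_code_expect mu Rc f W (fun x y => indic (~~ typical P dl [tuple of zip x y]))).
rewrite (_ : rsum _ = rsum (fun z : n.-tuple (X * X) => iid P z * indic (~~ typical P dl z))).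
  apply: (Rle_trans _ _ _ (weak_law P_pmf n_gt0 dl0)); apply: Rle_trans A_le.
  by apply: Req_le; rewrite /Rdiv Rinv_mult (Rmult_comm (/ INR n)) Rmult_assoc.
rewrite -rsum_zip; apply: eq_rsum => x; rewrite -rsumMl; apply: eq_rsum => y.
rewrite -Rmult_assoc; congr (_ * _); rewrite -iid_zip.
by apply: eq_bigr => i _; rewrite PE.
Qed.

End Codes.

(** At length [n], take an object good at the highest level [m <= n] attainable there. Since
    goodness passes to lower levels, level [m] holds as soon as [n] exceeds both [m] and its
    threshold. *)
Lemma diagonal_choice (C : nat -> Type) (ok : forall n, C n -> Prop)
    (good : forall n : nat, nat -> C n -> Prop) :
  (forall n, exists c, ok n c) -> (forall n m c, good n m c -> ok n c) ->
  (forall n m c, good n m.+1 c -> good n m c) ->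
  (forall m : nat, exists N : nat, forall n, (N <= n)%nat -> exists c, good n m c) ->
  exists f : forall n, C n, (forall n, ok n (f n)) /\
    forall m : nat, exists N : nat, forall n, (N <= n)%nat -> good n m (f n).
Proof.
move=> ok_ex good_ok goodS good_ex.
have best n (k : nat) : exists c, ok n c /\
    forall m, (m <= k)%nat -> (exists c', good n m c') -> good n m c.
  elim: k => [|k [c [cok cP]]].
    have [[c cG]|none] := classic (exists c, good n 0%nat c).
      by exists c; split=> [|m]; [exact: good_ok cG | rewrite leqn0 => /eqP->].
    have [c cok] := ok_ex n; exists c; split=> // m.
    by rewrite leqn0 => /eqP-> /none.
  have [[c' cG]|none] := classic (exists c', good n k.+1 c').
    exists c'; split=> [|m mk _]; first exact: good_ok cG.
    move: (subnKC mk) => {mk}; move: (k.+1 - m)%nat => j; move: cG.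
    elim: j m k.+1 => [|j IHj] m k1 cG jE.
      by move: cG; rewrite -jE addn0.
    by apply/goodS/(IHj _ k1) => //; rewrite addSnnS.
  exists c; split=> // m; rewrite leq_eqVlt => /orP[/eqP->|]; first by move=> /none.
  by rewrite ltnS; exact: cP.
pose f n := proj1_sig (constructive_indefinite_description _ (best n n)).
have fP n := proj2_sig (constructive_indefinite_description _ (best n n)).
exists f; split=> [n|m]; first by case: (fP n).
have [N NP] := good_ex m; exists (maxn N m) => n; rewrite geq_max => /andP[Nn mn].
by apply: (proj2 (fP n)) => //; exact: NP.
Qed.

(** * From typical codes to achievability of the rate set *)

Section Achievability.
Variables (X : finType) (d : X -> X -> R) (p : R) (mu psi : X -> R) (D Rr Rc : R).
Hypotheses (mu_pmf : is_pmf mu) (psi_pmf : is_pmf psi).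

(** One [eps] serves as excess distortion, total variation threshold and probability bound, so
    goodness is monotone in a single parameter. *)
Definition good_code n (eps : R) (c : encoder X n Rr Rc * decoder X n Rr Rc) : Prop :=
  [/\ valid_code c.1 c.2,
      code_expect mu c.1 c.2 (fun x _ _ y => avg_dist d p x y) <= D + eps &
      code_expect mu c.1 c.2
        (fun _ _ _ y => if Rlt_dec eps (tv (emp y) psi) then 1 else 0) <= eps].

Lemma tv_indic_le n (y : n.-tuple X) e1 e2 : e1 <= e2 ->
  (if Rlt_dec e2 (tv (emp y) psi) then 1 else 0) <=
  (if Rlt_dec e1 (tv (emp y) psi) then 1 else 0).
Proof. by case: (Rlt_dec e1) => h1; case: (Rlt_dec e2) => h2 /=; lra. Qed.

Lemma good_codeW n e1 e2 c : e1 <= e2 -> @good_code n e1 c -> good_code e2 c.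
Proof.
move=> e12 [ok dist tve]; split=> //; first lra.
apply: (Rle_trans _ e1); last exact: e12.
apply: Rle_trans tve; apply: code_expect_le => // x _ _ y; exact: tv_indic_le.
Qed.

Lemma good_codes_achievable :
  (forall eps, 0 < eps -> exists N : nat, forall n, (N <= n)%nat ->
    exists c, @good_code n eps c) ->
  emp_achievable d p mu psi D Rr Rc.
Proof.
move=> good_ex.
have inv_gt0 (m : nat) : 0 < / INR m.+1 by apply/Rinv_0_lt_compat/lt_0_INR/ltP.
have [] := @diagonal_choice (fun n => encoder X n Rr Rc * decoder X n Rr Rc)%type
  (fun n c => valid_code c.1 c.2) (fun n m c => @good_code n (/ INR m.+1) c).
(* [X] is nonempty because it carries the law [psi]; a constant word then gives a default code at
   every length. *)
- move=> n; have [b0 _] := exists_ge_mean (fun _ => 0) psi_pmf.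
  pose y0 : n.-tuple X := [tuple of nseq n b0].
  exists (det_encoder (fun _ => code_index0 n Rr), keyless_decoder (fun _ y => indic (y == y0))).
  by apply: det_code_ok => j; exact: indic_pmf.
- by move=> n m c [].
- move=> n m c; apply: good_codeW; apply: Rinv_le_contravar.
    by apply/lt_0_INR/ltP.
  by apply/le_INR/leP.
- by move=> m; exact: good_ex.
move=> f [f_ok fP].
exists (fun n => (f n).1), (fun n => (f n).2); split=> //; split.
  move=> eps eps0; have [m mP] := inv_nat_eventually_lt eps0.
  have [N NP] := fP m; exists N => n Nn; have [_ dist _] := NP n Nn.
  by have := mP m (leqnn m); lra.
move=> eps eps0 e' e'0; have min0 : 0 < Rmin eps e' by exact: Rmin_glb_lt.
have [m mP] := inv_nat_eventually_lt min0; have {}mP := mP m (leqnn m).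
have m1 := Rlt_le_trans _ _ _ mP (Rmin_l _ _).
have m2 := Rlt_le_trans _ _ _ mP (Rmin_r _ _).
have [N NP] := fP m; exists N => n /leP Nn; have [_ _ tv_le] := NP n Nn.
rewrite /R_dist Rminus_0_r Rabs_right.
  apply: Rle_lt_trans m2; apply: Rle_trans tv_le; apply: code_expect_le => // x _ _ y.
  exact/tv_indic_le/Rlt_le.
apply: Rle_ge; rewrite -[X in X <= _](code_expect_const mu_pmf (f_ok n) 0).
apply: code_expect_le => // x _ _ y.
by case: Rlt_dec => _ /=; lra.
Qed.

(** Bounds the distortion of any two words, and also scales the distortion error under
    typicality. *)
Let C := rsum (fun c : X * X => rho d p c.1 c.2).
Let C_ge0 : 0 <= C. Proof. by apply: rsum_ge0 => c; exact: rho_ge0. Qed.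

Lemma typical_code_good n (enc : encoder X n Rr Rc) (dec : decoder X n Rr Rc) P eps dl :
  (0 < n)%nat -> is_pmf P -> (forall b, rsum (fun a => P (a, b)) = psi b) ->
  rsum (fun c => P c * rho d p c.1 c.2) <= D + eps / 2 ->
  0 < dl -> 4 * dl * (C + INR #|{: X * X}| + 1) <= eps ->
  valid_code enc dec -> atypical_prob mu P dl enc dec <= dl -> good_code eps (enc, dec).
Proof.
move=> n0 P_pmf P_snd dist dl0 dl_le ok atyp; set kap := INR _ in dl_le.
have kap0 : 0 <= kap by exact: pos_INR.
have dlC : 0 <= dl * C by apply: Rmult_le_pos; lra.
have dlk : 0 <= dl * kap by apply: Rmult_le_pos; lra.
split=> //=.
  apply: (@Rle_trans _ (code_expect mu enc dec (fun x _ _ y =>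
    (D + eps / 2 + dl * C) + C * indic (~~ typical P dl [tuple of zip x y])))).
    apply: code_expect_le => // x _ _ y; rewrite avg_distE.
    case: (boolP (typical P dl _)) => [typ|_] /=.
      apply: (Rle_trans _ _ _ (typical_mean (fun c => rho d p c.1 c.2) typ)).
      have -> : rsum (fun c : X * X => Rabs (rho d p c.1 c.2)) = C.
        by apply: eq_rsum => c; rewrite Rabs_right //; exact/Rle_ge/rho_ge0.
      lra.
    apply: (@Rle_trans _ C).
      apply: rsum_le => c; rewrite -[X in _ <= X]Rmult_1_l.
      by apply: Rmult_le_compat_r; [exact: rho_ge0 | exact/pmf_le1/emp_pmf].
    have : 0 <= rsum (fun c => P c * rho d p c.1 c.2).
      by apply: rsum_ge0 => c; apply: Rmult_le_pos; [exact: (proj1 P_pmf) | exact: rho_ge0].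
    move=> /Rle_trans/(_ dist); lra.
  rewrite (code_expectD mu enc dec (fun _ _ _ _ => D + eps / 2 + dl * C)
    (fun x _ _ y => C * indic (~~ typical P dl [tuple of zip x y]))).
  rewrite code_expect_const // (code_expectMl mu enc dec C
    (fun x _ _ y => indic (~~ typical P dl [tuple of zip x y]))) -/(atypical_prob _ _ _ _ _).
  have := Rmult_le_compat_l _ _ _ C_ge0 atyp; lra.
apply: (@Rle_trans _ (atypical_prob mu P dl enc dec)); last by lra.
apply: code_expect_le => // x _ _ y.
case: (boolP (typical P dl _)) => [/typicalP typ|_] /=; last by case: Rlt_dec => _ /=; lra.
case: Rlt_dec => [|_] /=; last by lra.
suff : tv (emp y) psi <= eps by lra.
(* Each output frequency is a sum of joint frequencies, each off by at most [dl]. *)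
have : rsum (fun b => Rabs (emp y b - psi b)) <= rsum (fun _ : X * X => dl).
  rewrite -(rsum_pair (fun _ _ : X => dl)) exchange_rsum; apply: rsum_le => b.
  rewrite (emp_zip_snd x) -P_snd -rsumB; apply: (Rle_trans _ _ _ (rsum_abs_le _)).
  by apply: rsum_le => a; exact: typ.
by rewrite rsum_const /tv -/kap; lra.
Qed.

(** The coupling may depend on [eps], which leaves room to perturb it. *)
Lemma typical_codes_achievable :
  (forall eps, 0 < eps -> exists P : X * X -> R,
    [/\ is_pmf P, forall b, rsum (fun a => P (a, b)) = psi b,
      rsum (fun c => P c * rho d p c.1 c.2) <= D + eps &
      forall dl0, 0 < dl0 -> exists dl, 0 < dl <= dl0 /\ exists N : nat,
        forall n, (N <= n)%nat -> exists (enc : encoder X n Rr Rc) (dec : decoder X n Rr Rc),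
          valid_code enc dec /\ atypical_prob mu P dl enc dec <= dl]) ->
  emp_achievable d p mu psi D Rr Rc.
Proof.
move=> typ_ex; apply: good_codes_achievable => eps eps0.
have [P [P_pmf P_snd dist codes]] := typ_ex (eps / 2) ltac:(lra).
pose S := C + INR #|{: X * X}| + 1.
have S0 : 0 < S by have := pos_INR #|{: X * X}|; rewrite /S; lra.
have [dl [[dl0 dl_le] [N NP]]] := codes (eps / (4 * S)) ltac:(apply: Rdiv_lt_0_compat; lra).
exists N.+1 => -[//|n] Nn; have [enc [dec [ok atyp]]] := NP n.+1 (ltnW Nn).
exists (enc, dec); apply: (typical_code_good _ P_pmf P_snd dist dl0) => //.
rewrite -/S (_ : eps = 4 * (eps / (4 * S)) * S); last by field; lra.
by apply: Rmult_le_compat_r; lra.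
Qed.

Lemma product_pmf : is_pmf (fun c : X * X => mu c.1 * psi c.2).
Proof.
have [m0 m1] := mu_pmf; have [p0 p1] := psi_pmf.
split=> [c|]; first by apply: Rmult_le_pos.
rewrite -(rsum_pair (fun a b => mu a * psi b)) -m1; apply: eq_rsum => a.
by rewrite rsumMl p1; ring.
Qed.

Lemma mix_xlnx_le (l r : R) : 0 < l < 1 -> 0 <= r ->
  ((1 - l) * r + l) * ln ((1 - l) * r + l) <= (1 - l) * (r * ln r).
Proof.
move=> l01 r0; set s := (1 - l) * r + l; have s0 : 0 < s by rewrite /s; nra.
(* The graph of [x ln x] lies above its tangent at [s]; averaging over [t = r] and [t = 1] gives the
   convexity bound, as [x ln x] vanishes at 1. *)
have tangent t : 0 <= t -> t - s <= t * (ln t - ln s).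
  case=> [t0|<-]; last by lra.
  have := ln_le_sub1 (Rdiv_lt_0_compat _ _ s0 t0).
  rewrite /Rdiv ln_mult ?ln_Rinv //; last exact: Rinv_0_lt_compat.
  move=> /(Rmult_le_compat_l _ _ _ (Rlt_le _ _ t0)).
  rewrite (_ : t * (s * / t - 1) = s - t); last by field; lra.
  lra.
have := tangent r r0; have := tangent 1 ltac:(lra); rewrite ln_1 => t1 tr.
have : (1 - l) * (r - s) <= (1 - l) * (r * (ln r - ln s)) by apply: Rmult_le_compat_l; lra.
have : l * (1 - s) <= l * (1 * (0 - ln s)) by apply: Rmult_le_compat_l; lra.
have sE : s = (1 - l) * r + l by [].
have : s * ln s = ((1 - l) * r + l) * ln s by [].
nra.
Qed.

(** Equality case of Gibbs' inequality: the information is the product-law mean of [phi] of the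
    density, and [phi] is nonnegative with its only zero at 1. *)
Lemma density_one_of_mutual_info_le0 (P : X * X -> R) : is_pmf P ->
  (forall a, rsum (fun b => P (a, b)) = mu a) ->
  (forall b, rsum (fun a => P (a, b)) = psi b) ->
  rsum (fun c => P c * ln (density mu psi P c)) <= 0 ->
  forall c, P c = mu c.1 * psi c.2.
Proof.
move=> [P0 P1] P_fst P_snd I0 c.
pose phi r := r * ln r - r + 1.
have phi_gt0 r : 0 <= r -> r <> 1 -> 0 < phi r.
  rewrite /phi; case=> [r0|<-] r1; last by lra.
  have ln0 : - ln r <> 0 by move=> lnr; apply: r1; rewrite -(exp_ln r) // -exp_0; congr exp; lra.
  have := exp_ineq1 _ ln0; rewrite exp_Ropp exp_ln // => /(Rmult_lt_compat_l _ _ _ r0).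
  by rewrite Rinv_r; lra.
have r0 := density_ge0 P0 P_fst P_snd.
have phi_ge0 r : 0 <= r -> 0 <= phi r.
  move=> r_ge0; have [->|r1] := classic (r = 1); first by rewrite /phi ln_1; lra.
  exact/Rlt_le/phi_gt0.
have q0 c' : 0 <= mu c'.1 * psi c'.2 by apply: (proj1 product_pmf c').
have t0 c' : 0 <= mu c'.1 * psi c'.2 * phi (density mu psi P c').
  by apply: Rmult_le_pos; [exact: q0 | exact: phi_ge0].
have : rsum (fun c' => mu c'.1 * psi c'.2 * phi (density mu psi P c')) <= 0.
  rewrite (_ : rsum _ = rsum (fun c' => P c' * ln (density mu psi P c')) - rsum P +
      rsum (fun c' : X * X => mu c'.1 * psi c'.2)).
    by rewrite P1 (proj2 product_pmf); lra.
  rewrite -rsumB -rsumD; apply: eq_rsum => c'.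
  by rewrite [in RHS](densityK P0 P_fst P_snd c') /phi; ring.
move=> /(Rle_trans _ _ _ (le_rsum c t0)) t_le0.
rewrite [LHS](densityK P0 P_fst P_snd c).
have [-> | r1] := classic (density mu psi P c = 1); first by ring.
have := phi_gt0 _ (r0 c) r1; have := q0 c; nra.
Qed.

Lemma rate_set_achievable :
  0 < D -> 0 <= Rr -> rate_set d p mu psi D Rr -> emp_achievable d p mu psi D Rr Rc.
Proof.
move=> D0 Rr0 [P [P_pmf [P_fst [P_snd [dist]]]]]; have [P0 P1] := P_pmf.
rewrite (mutual_infoE P_fst P_snd) => I_le; have l2 := ln2_gt0.
have {}I_le : rsum (fun c => P c * ln (density mu psi P c)) <= Rr * ln 2.
  move: I_le => /(Rmult_le_compat_r _ _ _ (Rlt_le _ _ l2)).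
  by rewrite /Rdiv Rmult_assoc Rinv_l; lra.
apply: typical_codes_achievable => eps eps0.
have [Rr_gt0|Rr_0] : 0 < Rr \/ Rr = 0 by lra.
  (* The mixing weight keeps the added distortion [l * C] below [eps]. *)
  pose l := Rmin (1 / 2) (eps / (C + 1)).
  have l0 : 0 < l by apply: Rmin_glb_lt; [lra | apply: Rdiv_lt_0_compat; lra].
  have l1 : l < 1 by have := Rmin_l (1 / 2) (eps / (C + 1)); rewrite -/l; lra.
  have lC : l * C <= eps.
    have : l * (C + 1) <= eps / (C + 1) * (C + 1).
      by apply: Rmult_le_compat_r; [lra | exact: Rmin_r].
    by rewrite (_ : _ / _ * _ = eps); [lra | field; lra].
  pose Q c := (1 - l) * P c + l * (mu c.1 * psi c.2).
  have [q0 q1] := product_pmf.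
  have Q_pmf : is_pmf Q.
    split=> [c|]; last by rewrite /Q rsumD !rsumMl P1 q1; ring.
    by apply: Rplus_le_le_0_compat; apply: Rmult_le_pos; try lra; [exact: P0 | exact: (q0 c)].
  have Q_fst a : rsum (fun b => Q (a, b)) = mu a.
    by rewrite /Q rsumD !rsumMl P_fst /= rsumMl (proj2 psi_pmf); ring.
  have Q_snd b : rsum (fun a => Q (a, b)) = psi b.
    by rewrite /Q rsumD !rsumMl P_snd /= rsumMr (proj2 mu_pmf); ring.
  exists Q; split=> //; last first.
    apply: (covering_code _ mu_pmf psi_pmf Q_pmf Q_fst Q_snd) => //.
    (* Convexity shrinks the information by the factor [1 - l], which makes it strictly smaller than
       the positive rate. *)
    apply: (@Rle_lt_trans _ ((1 - l) * rsum (fun c => P c * ln (density mu psi P c)))).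
      rewrite -rsumMl; apply: rsum_le => c; set q := mu c.1 * psi c.2.
      have qc0 : 0 <= q := q0 c.
      rewrite {1}(densityK (proj1 Q_pmf) Q_fst Q_snd c) -/q.
      rewrite {1}(densityK P0 P_fst P_snd c) -/q.
      have [q_gt0|q_0] : 0 < q \/ q = 0 by lra.
        have -> : density mu psi Q c = (1 - l) * density mu psi P c + l.
          by rewrite /density -/q {1}/Q -/q; field; lra.
        have := mix_xlnx_le (conj l0 l1) (density_ge0 P0 P_fst P_snd c).
        move=> /(Rmult_le_compat_l _ _ _ qc0); lra.
      by rewrite q_0; lra.
    have : 0 < Rr * ln 2 by apply: Rmult_lt_0_compat.
    nra.
  rewrite /Q; under eq_rsum => c do rewrite Rmult_plus_distr_r !Rmult_assoc.
  rewrite rsumD !rsumMl.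
  apply: Rplus_le_compat.
    by apply: (@Rle_trans _ ((1 - l) * D)); [apply: Rmult_le_compat_l => //; lra | nra].
  apply: Rle_trans lC; apply: Rmult_le_compat_l; first lra.
  apply: rsum_le => c; rewrite -Rmult_assoc -[X in _ <= X]Rmult_1_l.
  apply: Rmult_le_compat_r; first exact: rho_ge0.
  exact: (pmf_le1 c product_pmf).
exists P; split=> //; first by apply: (Rle_trans _ _ _ dist); lra.
move=> dl0 dl00; exists dl0; split; first lra.
have PE : forall c, P c = mu c.1 * psi c.2.
  by apply: density_one_of_mutual_info_le0 => //; rewrite Rr_0 Rmult_0_l in I_le.
exact: (product_code Rr Rc psi_pmf PE P_pmf dl00).
Qed.

End Achievability.

Unset Implicit Arguments.

Theorem theorem3 (X : finType) (d : X -> X -> R) (p : R) (mu psi : X -> R) (D : R) :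
  is_metric d -> 0 < p -> is_pmf mu -> is_pmf psi -> 0 < D ->
  forall Rr Rc : R, 0 <= Rr -> 0 <= Rc ->
    (emp_achievable d p mu psi D Rr Rc <-> emp_achievable d p mu psi D Rr 0) /\
    (emp_achievable d p mu psi D Rr 0 <-> rate_set d p mu psi D Rr).
Proof.
move=> _ _ mu_pmf psi_pmf D0 Rr Rc Rr0 _.
(* Both inclusions hold for an arbitrary key rate, so key rates [Rc] and 0 are compared through the
   rate set. *)
have conv Rc' : emp_achievable d p mu psi D Rr Rc' -> rate_set d p mu psi D Rr.
  exact: achievable_rate_set.
have ach Rc' : rate_set d p mu psi D Rr -> emp_achievable d p mu psi D Rr Rc'.
  exact: rate_set_achievable.
by split; split=> h; [apply/ach/(conv Rc) | apply/ach/(conv 0) | exact: conv h | exact: ach].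
Qed.
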